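(* Let $T>0$, let $\mathbb{U}\subset\mathbb{R}^m$ be compact and non-empty, and let $f:[0,T]\times\mathbb{R}^n\times\mathbb{U}\to\mathbb{R}^n$ be continuous, Lipschitz continuous in $x$ uniformly in $(s,u)$, and such that $f(s,x,\mathbb{U})=\{f(s,x,u)\,|\,u\in\mathbb{U}\}$ is convex for every $(s,x)\in[0,T]\times\mathbb{R}^n$. Let $g\in C(\mathbb{R}^n;\mathbb{R})$ and $\mathcal{X}=\{x\in\mathbb{R}^n\,|\,g(x)\le 0\}$. Let $\overline{v}\in C([0,T]\times\mathbb{R}^n;\mathbb{R})$ be a viscosity supersolution of $-v_t+H(t,x,\nabla v)=0$ on $\Omega=\{(t,x)\in(0,T)\times\mathbb{R}^n\,|\,\overline{v}(t,x)<0\}$, with $\overline{v}(T,x)=\overline{g}(x)$ for all $x\in\mathbb{R}^n$. If $x\mapsto\overline{v}(t,x)$ is of class $\mathcal{Z}$ for every $t\in[0,T]$ and $\overline{g}(x)>0$ for all $x\notin\mathcal{X}$, then for every $t\in[0,T]$, $$\underline{\mathcal{G}}(t):=\{x\in\mathbb{R}^n\,|\,\overline{v}(t,x)\le 0\}\subseteq\mathcal{G}(t).$$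
   Context: For $t\in[0,T]$, $\mathcal{U}[t,T]$ is the set of measurable maps $u:[t,T]\to\mathbb{U}$. For $x\in\mathbb{R}^n$ and $u\in\mathcal{U}[t,T]$, $\varphi(\cdot;t,x,u)$ denotes the unique (absolutely continuous) solution of $\dot{x}(s)=f(s,x(s),u(s))$ for a.e. $s\in(t,T)$, $x(t)=x$. The backwards reachable set is $\mathcal{G}(t)=\{x\in\mathbb{R}^n\,|\,\exists u\in\mathcal{U}[t,T]\text{ with }\varphi(T;t,x,u)\in\mathcal{X}\}$. The Hamiltonian is $H(t,x,p)=\max_{u\in\mathbb{U}}\langle -p,f(t,x,u)\rangle$. For an open set $\Omega\subseteq(0,T)\times\mathbb{R}^n$, a function $v\in C([0,T]\times\mathbb{R}^n;\mathbb{R})$ is a viscosity supersolution (resp. subsolution) of $-v_t+H(t,x,\nabla v)=0$ on $\Omega$ if for every $\xi\in C^1(\Omega;\mathbb{R})$ such that $v-\xi$ attains a local minimum (resp. local maximum) at $(t_0,x_0)\in\Omega$, one has $-\xi_t(t_0,x_0)+H(t_0,x_0,\nabla\xi(t_0,x_0))\ge 0$ (resp. $\le 0$). A function $z:\mathbb{R}^n\to\mathbb{R}$ is of class $\mathcal{Z}$ if for every $\bar{x}$ with $z(\bar{x})=0$ and every $r>0$ there exists $x$ with $\|x-\bar{x}\|<r$ and $z(x)<0$. *)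

(* Defs.v *)
From HB Require Import structures.
From mathcomp Require Import all_boot all_order all_algebra.
From mathcomp Require Import all_classical all_reals all_analysis.
Set Implicit Arguments. Unset Strict Implicit. Unset Printing Implicit Defensive.
Import Order.TTheory GRing.Theory Num.Theory numFieldNormedType.Exports.
Local Open Scope classical_set_scope.
Local Open Scope ring_scope.

Section defs.
Context {R : realType} {n m : nat}.
Local Notation vec := 'rV[R]_n.
Local Notation ctrl := 'rV[R]_m.

Definition dotv (p q : vec) : R := \sum_(i < n) p 0 i * q 0 i.

(* Lebesgue measurable subsets of R: completion of the Borel sets w.r.t.
   Lebesgue measure (differ from a Borel set by a subset of a null Borel set). *)
Definition leb_measurable (A : set R) : Prop :=
  exists B N : set R, [/\ measurable B, measurable N,
    lebesgue_measure N = 0%E & (A `\` B) `|` (B `\` A) `<=` N].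

(* u in U[t,T]: a (Lebesgue) measurable map [t,T] -> U (measurability of an
   R^m-valued map = measurability of each coordinate w.r.t. Borel sets). *)
Definition admissible_control (U : set ctrl) (t T : R) (u : R -> ctrl) : Prop :=
  (forall s, t <= s <= T -> U (u s)) /\
  (forall (i : 'I_m) (Y : set R), measurable Y ->
     leb_measurable ([set s | t <= s <= T] `&` ((fun s => u s 0 i) @^-1` Y))).

Definition abs_cont_on (a b : R) (phi : R -> vec) : Prop :=
  forall e : R, 0 < e -> exists2 d : R, 0 < d &
    forall (k : nat) (al bl : nat -> R),
      (forall i, (i < k)%N -> a <= al i /\ al i <= bl i /\ bl i <= b) ->
      (forall i j, (i < j)%N -> (j < k)%N -> bl i <= al j) ->
      \sum_(i < k) (bl i - al i) < d ->
      \sum_(i < k) `|phi (bl i) - phi (al i)| < e.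

Definition is_solution (T : R) (f : R -> vec -> ctrl -> vec) (t : R) (x : vec)
    (u : R -> ctrl) (phi : R -> vec) : Prop :=
  [/\ phi t = x, abs_cont_on t T phi &
      {ae (@lebesgue_measure R), forall s, t < s < T ->
          is_derive s 1 phi (f s (phi s) (u s))}].

Definition reach_set (T : R) (f : R -> vec -> ctrl -> vec) (U : set ctrl)
    (g : vec -> R) (t : R) : set vec :=
  [set x | exists u, admissible_control U t T u /\
     exists phi, is_solution T f t x u phi /\ g (phi T) <= 0].

(* Hamiltonian H(t,x,p) = max_{u in U} <-p, f(t,x,u)> (written as a sup;
   the max is attained when U is compact and f continuous) *)
Definition hamiltonian (f : R -> vec -> ctrl -> vec) (U : set ctrl)
    (t : R) (x : vec) (p : vec) : R :=
  sup [set dotv (- p) (f t x u) | u in U].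

Definition C1_on (Om : set (R * vec)) (xi : R * vec -> R) : Prop :=
  (forall z, Om z -> differentiable xi z) /\
  (forall w : R * vec, forall z, Om z -> {for z, continuous (fun y => 'D_w xi y)}).

Definition time_deriv (xi : R * vec -> R) (z : R * vec) : R :=
  'D_((1 : R), (0 : vec)) xi z.

Definition grad (xi : R * vec -> R) (z : R * vec) : vec :=
  \row_i 'D_((0 : R), (delta_mx 0 i : vec)) xi z.

Definition viscosity_supersol (f : R -> vec -> ctrl -> vec) (U : set ctrl)
    (Om : set (R * vec)) (v : R -> vec -> R) : Prop :=
  forall xi : R * vec -> R, C1_on Om xi ->
  forall z0 : R * vec, Om z0 ->
    (\forall z \near z0, v z0.1 z0.2 - xi z0 <= v z.1 z.2 - xi z) ->
    0 <= - time_deriv xi z0 + hamiltonian f U z0.1 z0.2 (grad xi z0).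

Definition Omega (T : R) (v : R -> vec -> R) : set (R * vec) :=
  [set z | 0 < z.1 < T /\ v z.1 z.2 < 0].

Definition classZ (z : vec -> R) : Prop :=
  forall xb, z xb = 0 -> forall r : R, 0 < r ->
    exists x, `|x - xb| < r /\ z x < 0.

End defs.

(* Main.v *)
(** A point with v(t1,x1) < 0 is followed by an Euler polygon along which the
    inf-convolution of v with a quadratic kernel of width lam grows only by
    O(h^2 / lam) per step: the kernel is a test function at the minimiser, and
    the supersolution inequality there provides a control whose velocity does
    not increase the inf-convolution to first order.  Letting h << lam -> 0, the
    polygons stay in the sublevel set and cluster pointwise at a Lipschitz curve z
    with v(T,z(T)) <= 0; by convexity of the velocity sets every derivative of z
    is an admissible velocity.  Lipschitz curves are differentiable almost
    everywhere (Radon-Nikodym and Lebesgue points), and Filippov's measurable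
    selection yields the control.  Since class Z makes {v <= 0} the closure of
    {v < 0} in space, starting points with v = 0 are limits of such points. *)

Require Import Defs.
From HB Require Import structures.
From mathcomp Require Import all_boot all_order all_algebra.
From mathcomp Require Import all_classical all_reals all_analysis.
Import Order.TTheory GRing.Theory Num.Theory numFieldNormedType.Exports.
From mathcomp Require Import measurable_realfun zify ring lra.
Set Implicit Arguments.
Unset Strict Implicit.
Unset Printing Implicit Defensive.
Local Open Scope classical_set_scope.
Local Open Scope ring_scope.

(** * Almost everywhere differentiability of Lipschitz functions *)

(** [v] has no gradient to follow: the supersolution inequality is available only where a smooth
    function touches [v] from below inside [Omega], that is, at interior times and where [v < 0].
    This shapes the construction. The descent condition holds at the minimiser, not at the vertex of
    the polygon, so velocities are taken at a point within [d] of the vertex. The polygon runs over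
    [[t1, T - d]] with [t1 > t], away from both ends of [[0, T]], and the accumulated increase of
    the inf-convolution stays below [- v t1 x1], so that every minimiser used lies in [Omega]. All
    these defects are collected in the single error [e] of [almost_solution]. The constants are
    chosen in the order [d], [lam], [h]: with [2 * lam * M = d ^+ 2 / 2] the minimiser is within [d]
    of the vertex, and over a time span [S] the increase is [S * h * K] with [K] of order [1 / lam],
    which a small [h] makes as small as needed. *)

Section lipschitz_derivable.
Context {R : realType}.
Local Notation mu := (@lebesgue_measure R).
Implicit Types F K : R -> R.

(** Both sides are infima over the same covers by half-open intervals, and each interval has smaller
    weight under [K] than its length. *)
Lemma le_lebesgue_stieltjes_measure (K : cumulative R R) :
  (forall s t, s <= t -> K t - K s <= t - s) ->
  forall A, (lebesgue_stieltjes_measure K A <= mu A)%E.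
Proof.
move=> lipK A; rewrite /lebesgue_measure /lebesgue_stieltjes_measure.
rewrite /measure_extension /mu_ext; apply: le_ereal_inf_tmp => _ [B cB <-].
apply: (@le_trans _ _ (\sum_(k <oo) wlength K (B k))%E).
  by apply: ereal_inf_lbound; exists B.
apply: lee_nneseries => [k _ _|k _]; first exact: wlength_ge0.
have /ocitvP[->|[[a b] /= ab ->]] := cB.1 k; first by rewrite !wlength0.
by rewrite !(@wlength_itv_bnd _ _ a b false false (ltW ab)) lee_fin lipK// ltW.
Qed.

(* A nondecreasing 1-Lipschitz K generates a measure below Lebesgue measure, so
   its Radon-Nikodym density is the derivative of K at every Lebesgue point. *)
Lemma nondecreasing_lipschitz1_derivable_ae K (a b : R) : a < b ->
  {homo K : s t / s <= t} -> (forall s t, s <= t -> K t - K s <= t - s) ->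
  exists2 w : R -> R, measurable_fun setT w &
    {ae mu, forall s, a < s < b -> is_derive s (1 : R) K (w s)}.
Proof.
move=> ab ndK lipK.
have cK : continuous K.
  move=> x; apply/cvgrPdist_le => e e0; near=> y.
  have : `|x - y| <= e by near: y; apply: cvgr_dist_le.
  apply: le_trans; case: (leP x y) => xy.
    by rewrite !ler0_norm ?subr_le0// ?opprB ?lipK// ndK.
  by rewrite !ger0_norm ?subr_ge0 ?lipK ?ndK// ltW.
pose Kc := isCumulative.Build R _ R K ndK (right_continuousW cK).
pose KC : cumulative R R := HB.pack K Kc.
pose D : set R := `]a, b]%classic.
have mD : measurable D by exact: measurable_itv.
have Kle := @le_lebesgue_stieltjes_measure KC lipK.
have Doo : (lebesgue_stieltjes_measure KC D < +oo)%E.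
  by apply: (le_lt_trans (Kle _)); rewrite lebesgue_measure_itv/=; case: ifP => _; rewrite ltry.
pose lam : {measure set (measurableTypeR R) -> \bar R} := lebesgue_stieltjes_measure KC.
(* Restricting to the bounded interval [D] makes the measure finite, hence a charge to which
   Radon-Nikodym applies. *)
pose nu0 : {finite_measure set (measurableTypeR R) -> \bar R} :=
  @mfrestr _ (measurableTypeR R) R D lam mD Doo.
pose nu : {charge set (measurableTypeR R) -> \bar R} := charge_of_finite_measure nu0.
have numu : nu `<< mu.
  apply/null_content_dominatesP => A mA muA0; apply/eqP.
  rewrite eq_le measure_ge0 andbT -muA0 /nu /charge_of_finite_measure /nu0 /mfrestr /mrestr.
  by apply: le_trans (Kle _) _; apply: le_measure; rewrite ?inE//; exact: measurableI.
pose w := fine \o Radon_Nikodym nu mu.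
have wE : EFin \o w = Radon_Nikodym nu mu.
  by apply/funext => x /=; rewrite fineK// Radon_Nikodym_fin_num.
have intw : mu.-integrable setT (EFin \o w).
  by rewrite wE; exact: Radon_Nikodym_integrable.
have mw : measurable_fun setT w.
  by have /integrableP[/measurable_EFinP] := intw.
exists w => //.
have KE x : a < x <= b -> K x = K a + \int[mu]_(s in `]a, x]) w s.
  move=> /andP[ax xb].
  suff : nu `]a, x]%classic = (K x - K a)%:E.
    rewrite (Radon_Nikodym_integral numu (measurable_itv `]a, x])) -wE.
    by move=> /(congr1 fine) /= wi; rewrite /Rintegral wi addrC subrK.
  rewrite /nu /charge_of_finite_measure /nu0 /= /mfrestr /mrestr setIidl; last first.
    by move=> z; rewrite /D/= !in_itv/= => /andP[-> /le_trans]; apply.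
  rewrite /lam /= /lebesgue_stieltjes_measure /measure_extension.
  rewrite (@measurable_mu_extE _ _ _ (wlength KC)); last exact: is_ocitv.
  by rewrite /= (wlength_itv_bnd K false false (ltW ax)).
have lw : locally_integrable setT w.
  by have := integrable_locally measurableT intw; rewrite patch_setT.
have := lebesgue_differentiation lw.
apply: filterS; first exact: (ae_filter_ringOfSetsType mu).
move=> s sw /andP[as_ sb].
have intwb : mu.-integrable [set` Interval (BRight a) (BRight b)] (EFin \o w).
  exact: integrableS intw.
have [der derE] := @FTC1_lebesgue_pt _ w (BRight a) s b sb intwb as_ sw.
apply: (@near_eq_is_derive _ _ _ (fun x => K a + \int[mu]_(s in `]a, x]) w s)).
  near=> x; rewrite (KE x)//; apply/andP; split; last apply: ltW.
    by near: x; exact: lt_nbhsr.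
  by near: x; exact: lt_nbhsl.
apply: is_derive_eq; first by apply: is_deriveD; exact: DeriveDef der erefl.
by rewrite add0r -derive1E.
Unshelve. all: by end_near. Qed.

Lemma lipschitz_derivable_ae F (L a b : R) :
  (forall s t, `|F s - F t| <= L * `|s - t|) ->
  exists2 w : R -> R, measurable_fun setT w &
    {ae mu, forall s, a < s < b -> is_derive s (1 : R) F (w s)}.
Proof.
move=> lipF; have [ba|ab] := leP b a.
  exists (cst 0) => //; apply: aeW => s /andP[as_ sb].
  by have := lt_trans as_ (lt_le_trans sb ba); rewrite ltxx.
pose M := 1 + `|L|; have M0 : 0 < M by rewrite ltr_pwDl.
have lipM s t : s <= t -> `|F t - F s| <= M * (t - s).
  move=> st; apply: le_trans (lipF _ _) _; rewrite (ger0_norm (_ : 0 <= t - s)) ?subr_ge0//.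
  by rewrite ler_wpM2r ?subr_ge0// /M (le_trans (ler_norm _))// lerDr.
(* [F / M] has slopes in [[-1, 1]]; adding the identity and halving brings them into [[0, 1]], as
   the monotone case requires. *)
pose K s := (F s / M + s) / 2.
have KD s t : K t - K s = ((F t - F s) / M + (t - s)) / 2 by rewrite /K; field; lra.
have quot s t : s <= t -> `|(F t - F s) / M| <= t - s.
  move=> st; rewrite normrM [`|M^-1|]gtr0_norm ?invr_gt0//.
  by rewrite ler_pdivrMr// mulrC lipM.
have [||w mw Kw] := @nondecreasing_lipschitz1_derivable_ae K a b ab.
- move=> s t st; rewrite -subr_ge0 KD; have := quot _ _ st.
  rewrite ler_norml => /andP[? _]; lra.
- move=> s t st; rewrite KD; have := quot _ _ st.
  rewrite ler_norml => /andP[_ ?]; lra.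
exists (fun s => M * (2 * w s - 1)).
  apply: measurable_funM => //; apply: measurable_funB => //.
  exact: measurable_funM.
move: Kw; apply: filterS; first exact: (ae_filter_ringOfSetsType mu).
move=> s /[apply] dK.
have -> : F = (fun s => M *: (2 *: K s - s)).
  by apply/funext => x; rewrite /K/= /GRing.scale/=; field; lra.
by apply: is_derive_eq.
Qed.

End lipschitz_derivable.

(** * Measurable selection *)

Section measurable_selection.
Context {R : realType} {d : measure_display} {T : measurableType d} {m : nat}.
Implicit Types (G : T -> set 'rV[R]_m) (K : set 'rV[R]_m) (D : set T).

Let continuous_entry (i : 'I_m) : continuous (fun u : 'rV[R]_m => u 0 i).
Proof. exact: coord_continuous. Qed.

(** The weak inverse image of [K] under the multifunction [G]; its measurability for closed [K]
    serves as the measurability of [G]. *)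
Definition hit D G K : set T := [set s | D s /\ (G s `&` K) !=set0].

Let lowerset (i : 'I_m) (q : R) : set 'rV[R]_m := [set u | u 0 i <= q].

Let closed_lowerset i q : closed (lowerset i q).
Proof.
apply: (@closed_comp _ _ (fun u : 'rV[R]_m => u 0 i) [set x | x <= q]).
  by move=> u _; exact: continuous_entry.
exact: closed_le.
Qed.

(* The set of minimisers of the i-th coordinate is again weakly measurable: it
   meets K iff no rational separates the minimum over G s from the minimum over
   the intersection of G s with K. *)
Lemma argmin_coord_selection D G i : measurable D ->
  (forall s, D s -> compact (G s) /\ G s !=set0) ->
  (forall K, closed K -> measurable (hit D G K)) ->
  exists (G' : T -> set 'rV[R]_m) (c : T -> R),
    [/\ forall s, D s -> compact (G' s) /\ G' s !=set0,
        forall K, closed K -> measurable (hit D G' K),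
        measurable_fun D c,
        forall s, G' s `<=` G s &
        forall s u, D s -> G' s u -> u 0 i = c s].
Proof.
move=> mD cG mG.
have minG K s : closed K -> hit D G K s ->
    exists2 u, (G s `&` K) u & forall w, (G s `&` K) w -> u 0 i <= w 0 i.
  move=> cK [Ds [u0 u0GK]]; have [u]:= @compact_EVT_min _ R (fun u : 'rV[R]_m => u 0 i)
    (G s `&` K) (ex_intro _ _ u0GK) (compact_closedI (cG _ Ds).1 cK)
    (continuous_subspaceT (@continuous_entry i)).
  by rewrite inE => uGK umin; exists u => // w wGK; apply: umin; rewrite inE.
have hitT s : D s -> hit D G setT s.
  by move=> Ds; split=> //; rewrite setIT; exact: (cG _ Ds).2.
have /choice[c cP] : forall s, exists c : R, D s ->
    (exists2 u, G s u & u 0 i = c) /\ (forall w, G s w -> c <= w 0 i).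
  move=> s; have [Ds|nDs] := pselect (D s); last by exists 0.
  have [u [Gu _] umin] := minG setT s closedT (hitT _ Ds).
  by exists (u 0 i) => _; split; [exists u|move=> w Gw; exact: umin].
pose G' s := G s `&` [set u | u 0 i = c s].
have cle s q : D s -> (c s <= q) <-> hit D G (lowerset i q) s.
  move=> Ds; have [[u Gu uc] cmin] := cP _ Ds; split=> [cq|[_ [w [Gw wq]]]].
    by split=> //; exists u; split=> //; rewrite /lowerset/= uc.
  by apply: le_trans wq; exact: cmin.
exists G', c; split.
- move=> s Ds; split; last first.
    by have [[u Gu uc] _] := cP _ Ds; exists u.
  apply: compact_closedI; first exact: (cG _ Ds).1.
  apply: (@closed_comp _ _ (fun u : 'rV[R]_m => u 0 i) [set x | x = c s]).
    by move=> u _; exact: continuous_entry.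
  exact: closed_eq.
- move=> K cK.
  rewrite (_ : hit D G' K = hit D G K `\` \bigcup_(q in @setT rat)
      (hit D G (lowerset i (ratr q)) `\` hit D G (K `&` lowerset i (ratr q)))).
    apply: measurableD; first exact: mG.
    apply: bigcupT_measurable_rat => q; apply: measurableD; apply: mG => //.
    exact: closedI.
  apply/seteqP; split => s.
    move=> [Ds [u [[Gu uc] Ku]]]; split; first by split=> //; exists u.
    move=> [q _ [/(cle _ _ Ds) cq]]; apply; split=> //; exists u; split=> //.
    by split=> //; rewrite /lowerset/= uc.
  move=> [hK nsep]; have [Ds _] := hK; have [u [Gu Ku] umin] := minG _ _ cK hK.
  have [_ cmin] := cP _ Ds; split=> //; exists u; split=> //; split=> //=.
  apply/eqP; rewrite eq_le cmin// andbT leNgt; apply/negP => cu.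
  have [q] := rat_in_itvoo cu; rewrite in_itv/= => /andP[cq qu].
  apply: nsep; exists q => //; split; first by apply/(cle _ _ Ds)/ltW.
  move=> [_ [w [Gw [Kw wq]]]].
  by have := lt_le_trans qu (umin _ (conj Gw Kw)); rewrite ltNge wq.
- move=> _; apply: (measurability _ (RGenOInfty.measurableE R)) => //.
  move=> _ [_ [q ->] <-].
  rewrite (_ : _ `&` _ = D `\` hit D G (lowerset i q)).
    by apply: measurableD => //; exact: mG.
  apply/seteqP; split => s [Ds] /=; rewrite in_itv/= andbT.
    by move=> qc; split=> // /(cle _ _ Ds); rewrite leNgt qc.
  by move=> h; split=> //; rewrite ltNge; apply/negP => /(cle _ _ Ds).
- by move=> s u [].
- by move=> s u _ [].
Qed.

(** Minimising the coordinates one after another keeps the sets compact, nonempty and measurable;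
    after [m] rounds every coordinate is determined, so the selection is the lexicographic minimum
    of [G s]. *)
Lemma measurable_selection D G : measurable D ->
  (forall s, D s -> compact (G s) /\ G s !=set0) ->
  (forall K, closed K -> measurable (hit D G K)) ->
  exists2 u : T -> 'rV[R]_m, (forall s, D s -> G s (u s)) &
    forall i, measurable_fun D (fun s => u s 0 i).
Proof.
move=> mD cG mG.
have : forall k, exists (G' : T -> set 'rV[R]_m) (c : 'I_m -> T -> R),
    [/\ forall s, D s -> compact (G' s) /\ G' s !=set0,
        forall K, closed K -> measurable (hit D G' K),
        forall i : 'I_m, (i < k)%N -> measurable_fun D (c i),
        forall s, G' s `<=` G s &
        forall s u (i : 'I_m), (i < k)%N -> D s -> G' s u -> u 0 i = c i s].
  elim=> [|k [G1 [c1 [cG1 mG1 mc1 sG1 c1E]]]].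
    by exists G, (fun _ _ => 0); split=> [|||s|] // s u [] [].
  have [km|mk] := ltnP k m; last first.
    exists G1, c1; split=> // [i ik|s u i ik]; [apply: mc1|apply: c1E] => //;
      exact: leq_trans (ltn_ord i) mk.
  have [G2 [c2 [cG2 mG2 mc2 sG2 c2E]]] := argmin_coord_selection (Ordinal km) mD cG1 mG1.
  exists G2, (fun i => if i == Ordinal km then c2 else c1 i); split=> //.
  - move=> i ik; case: eqVneq => // /eqP ik'; apply: mc1.
    by rewrite ltn_neqAle -ltnS ik andbT; apply: contra_notN ik' => /eqP ?; exact: val_inj.
  - by move=> s u /sG2/sG1.
  - move=> s u i ik Ds G2u; case: eqVneq => [->|/eqP ik']; first exact: c2E.
    apply: c1E => //; last exact: sG2.
    by rewrite ltn_neqAle -ltnS ik andbT; apply: contra_notN ik' => /eqP ?; exact: val_inj.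
move=> /(_ m)[G' [c [cG' _ mc sG' cE]]].
have /choice[u uP] : forall s, exists u, D s -> G' s u.
  move=> s; have [Ds|nDs] := pselect (D s); last by exists 0.
  by have [_ [u]] := cG' _ Ds; exists u.
exists u => [s Ds|i]; first exact/sG'/uP.
apply: (eq_measurable_fun (c i)) => [s|]; last exact: mc.
by rewrite inE => Ds; rewrite (cE s (u s) i)//; exact: uP.
Qed.

End measurable_selection.

(** * Separability of subsets of R^n and Filippov's lemma *)

Lemma norm_rV_le {R : realType} {n : nat} (x : 'rV[R]_n) (e : R) : 0 <= e ->
  (forall i, `|x 0 i| <= e) -> `|x| <= e.
Proof.
move=> e0 xe; rewrite [leLHS]/Num.Def.normr/= mx_normrE.
by apply: bigmax_le => // -[i j] _; rewrite (ord1 i) xe.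
Qed.

Lemma norm_rV_coord {R : realType} {n : nat} (x : 'rV[R]_n) i : `|x 0 i| <= `|x|.
Proof.
rewrite [leRHS]/Num.Def.normr/= mx_normrE.
exact: (le_bigmax _ (fun ij : 'I_1 * 'I_n => `|x ij.1 ij.2|) (0, i)).
Qed.

Lemma within_continuous_dist {R : realType} {V W : normedModType R} (A : set V)
    (f : V -> W) : {within A, continuous f} -> forall x, A x ->
  forall e : R, 0 < e ->
    exists2 d : R, 0 < d & forall y, A y -> `|x - y| < d -> `|f x - f y| < e.
Proof.
move=> /subspace_continuousP cf x Ax e e0.
have /nbhs_ballP[d /= d0 H] : within A (nbhs x) [set y | `|f x - f y| < e].
  by have /cvgrPdist_lt := cf _ Ax; exact.
by exists d => // y Ay xy; apply: H => //; rewrite -ball_normE.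
Qed.

Lemma natSinv_lt {R : realType} (e : R) : 0 < e -> exists k : nat, k.+1%:R^-1 < e.
Proof.
move=> e0; have [k _ /(_ k (leqnn k)) ke] := near_infty_natSinv_lt (PosNum e0).
by exists k.
Qed.

(** Rational points need not lie in [A], so one point of [A] is picked in each ball of rational
    centre and radius [k.+1%:R^-1] that meets [A]; [x0] fills the other indices. *)
Lemma rV_dense_seq {R : realType} {n : nat} (A : set 'rV[R]_n) : A !=set0 ->
  exists2 a : nat -> 'rV[R]_n, (forall j, A (a j)) &
    forall x, A x -> forall e : R, 0 < e -> exists j, `|x - a j| < e.
Proof.
move=> [x0 Ax0].
pose Q (p : 'rV[rat]_n * nat) x := A x /\ `|x - map_mx ratr p.1| <= p.2.+1%:R^-1.
have /choice[F FP] : forall p, exists y, A y /\ ((exists x, Q p x) -> Q p y).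
  move=> p; have [[x Qx]|nQ] := pselect (exists x, Q p x).
    by exists x; split=> //; case: Qx.
  by exists x0; split.
exists (fun j => if unpickle j is Some p then F p else x0).
  by move=> j; case: unpickle => // p; exact: (FP p).1.
move=> x Ax e e0; have [k ke] := natSinv_lt (divr_gt0 e0 (ltr0Sn R 1)).
have /choice[q qP] : forall i, exists q : rat, `|x 0 i - ratr q| <= k.+1%:R^-1.
  move=> i; have : x 0 i - k.+1%:R^-1 < x 0 i + k.+1%:R^-1.
    by rewrite ltrD2l gt0_cp// invr_gt0.
  move=> /rat_in_itvoo[q]; rewrite in_itv/= => /andP[q1 q2]; exists q.
  by rewrite ler_distlC; rewrite !ltW.
pose p : 'rV[rat]_n * nat := (\row_i q i, k).
have Qp : Q p x.
  split=> //; apply: norm_rV_le => [|i]; first by rewrite invr_ge0.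
  by rewrite !mxE; exact: qP.
exists (pickle p); rewrite pickleK.
have [_ Fp] := (FP p).2 (ex_intro _ _ Qp).
rewrite (_ : x - F p = (x - map_mx ratr p.1) - (F p - map_mx ratr p.1)); last first.
  by rewrite opprB addrA subrK.
apply: le_lt_trans (ler_normB _ _) _.
by apply: le_lt_trans (lerD Qp.2 Fp) _; rewrite [ltRHS]splitr ltrD.
Qed.

(** On the compact set [U] intersected with a closed [K], the nonnegative continuous [F s] has a
    zero iff it takes arbitrarily small values on a countable dense subset. This writes the hit sets
    of the zero-set multifunction as countable intersections of countable unions. *)
Lemma filippov_selection {R : realType} {d : measure_display}
    {T : measurableType d} {m : nat} (U : set 'rV[R]_m) (D : set T)
    (F : T -> 'rV[R]_m -> R) :
  compact U -> measurable D -> (forall s u, 0 <= F s u) ->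
  (forall s, D s -> {within U, continuous (F s)}) ->
  (forall u, U u -> measurable_fun D (F ^~ u)) ->
  let E := [set s | D s /\ exists2 u, U u & F s u = 0] in
  measurable E /\
  exists2 u : T -> 'rV[R]_m, (forall s, E s -> U (u s) /\ F s (u s) = 0) &
    forall i, measurable_fun E (fun s => u s 0 i).
Proof.
move=> cU mD F0 cF mF E.
have mhit K : closed K -> measurable [set s | D s /\ exists2 u, (U `&` K) u & F s u = 0].
  move=> cK; have [[u0 Uu0]|UK0] := pselect (exists u, (U `&` K) u); last first.
    rewrite (_ : mkset _ = set0) //; apply/seteqP; split => // s [_ [u Uu _]].
    by apply: UK0; exists u.
  have cUK : compact (U `&` K) by exact: compact_closedI.
  have [a Aa aD] := @rV_dense_seq _ _ (U `&` K) (ex_intro _ _ Uu0).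
  rewrite (_ : mkset _ = \bigcap_(j in @setT nat) \bigcup_(k in @setT nat)
      (D `&` [set s | F s (a k) < j.+1%:R^-1])).
    apply: bigcapT_measurable => j; apply: bigcupT_measurable => k.
    rewrite (_ : D `&` _ = D `&` (F ^~ (a k)) @^-1` `]-oo, j.+1%:R^-1[%classic).
      by apply: (mF _ (Aa k).1 mD); exact: measurable_itv.
    by apply/seteqP; split => s [Ds] /=; rewrite in_itv.
  apply/seteqP; split => [s [Ds [u UKu Fu]] j _|s sP].
    have j0 : 0 < j.+1%:R^-1 :> R by rewrite invr_gt0.
    have [e e0 He] := within_continuous_dist (cF _ Ds) UKu.1 j0.
    have [k uk] := aD _ UKu _ e0; exists k => //; split=> //=.
    have := He _ (Aa k).1 uk; rewrite Fu sub0r normrN ger0_norm ?F0//.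
  have [_ _ [Ds _]] := sP 0%N I; split=> //.
  have [||c] := @compact_EVT_min _ R (F s) (U `&` K) _ cUK; first by exists u0.
    by apply: continuous_subspaceW (cF _ Ds) => u [].
  rewrite inE => UKc cmin; exists c => //; apply/eqP; rewrite eq_le F0 andbT leNgt.
  apply/negP => /natSinv_lt[j jc]; have [k _ [_ /= akj]] := sP j I.
  have := cmin (a k); rewrite inE => /(_ (Aa k)) /le_lt_trans /(_ akj).
  by rewrite ltNge (ltW jc).
have mE : measurable E by have := mhit setT closedT; rewrite setIT.
split=> //; pose G s := [set u | U u /\ F s u = 0].
have [s Es|K cK|u uG mu] := @measurable_selection R d T m E G mE; last first.
- by exists u.
- rewrite (_ : hit _ _ _ = [set s | D s /\ exists2 u, (U `&` K) u & F s u = 0]); first exact: mhit.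
  apply/seteqP; split => s.
    by move=> [[Ds _] [u [[Uu Fu] Ku]]]; split=> //; exists u.
  by move=> [Ds [u [Uu Ku] Fu]]; split; [split=> //; exists u|exists u].
- have [Ds [u Uu Fu]] := Es; split; last by exists u.
  have clU : closed U by apply: compact_closed => //; exact: norm_hausdorff.
  apply: (subclosed_compact _ cU); last by move=> w [].
  move=> x clx; have Ux : U x by apply: clU; apply: closure_subset clx => w [].
  split=> //; apply/eqP; rewrite eq_le F0 andbT leNgt; apply/negP => Fx0.
  have [e e0 He] := within_continuous_dist (cF _ Ds) Ux Fx0.
  have [w [[Uw Fw] xw]] := clx _ (nbhsx_ballx x e e0).
  have := He w Uw; rewrite Fw subr0 ger0_norm ?F0// ltxx.
  by move=> /(_ _)/negP; apply=> //; move: xw; rewrite -ball_normE.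
Qed.

Lemma ultra_fmap {S S' : Type} (h : S -> S') (G : set_system S) :
  UltraFilter G -> UltraFilter (h @ G).
Proof.
move=> GU; have GP : ProperFilter G by case: GU.
split; first exact: fmap_proper_filter.
move=> H HP GH; apply/seteqP; split=> // A HA.
have [//|GnA] := @in_ultra_setVsetC _ G (h @^-1` A) GU.
have [x [Ax nAx]] := filter_ex (filterI HA (GH (~` A) GnA)).
by case: nAx.
Qed.

(** * Limits of approximate trajectories *)

Lemma rV_closed_ball_compact {R : realType} {n : nat} (M : R) :
  compact [set x : 'rV[R]_n | `|x| <= M].
Proof.
apply: bounded_closed_compact.
  by exists M; split; [exact: num_real|move=> N MN x /= /le_trans; apply; exact: ltW].
apply: (@closed_comp _ _ (fun x : 'rV[R]_n => `|x|) [set r | r <= M]).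
  by move=> x _; exact: norm_continuous.
exact: closed_le.
Qed.

(** The limit is taken along one ultrafilter refining [\oo], so it exists at all points of [S] at
    once without any extraction of subsequences. Two points are enough below, since each condition
    passed to the limit involves at most two times. *)
Lemma pointwise_cluster {R : realType} {n : nat} {S : Type}
    (z : nat -> S -> 'rV[R]_n) :
  (forall s, exists M, forall k, `|z k s| <= M) ->
  exists zl : S -> 'rV[R]_n, forall s1 s2 (e : R) k0, 0 < e ->
    exists k, [/\ (k0 <= k)%N, `|z k s1 - zl s1| < e & `|z k s2 - zl s2| < e].
Proof.
move=> zb; have [G [GU sG]] := @ultraFilterLemma nat \oo _.
have GP : ProperFilter G by case: GU.
have /choice[zl zlP] : forall s, exists y : 'rV[R]_n, z^~ s @ G --> y.
  move=> s; have [M zM] := zb s.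
  have := @rV_closed_ball_compact R n M; rewrite compact_ultra.
  move=> /(_ (z^~ s @ G) (ultra_fmap _ GU))[|y [_ Gy]]; last by exists y.
  by apply: (@filterE _ G) => k; exact: zM.
exists zl => s1 s2 e k0 e0.
have G1 s : G [set k | `|z k s - zl s| < e].
  by have /cvgr_distC_lt := zlP s; exact.
have G0 : G [set k | (k0 <= k)%N] by apply: sG; exists k0.
have [k [[? ?] ?]] := filter_ex (filterI (filterI G0 (G1 s1)) (G1 s2)).
by exists k.
Qed.

(** Joint continuity gives a radius around each [u]; compactness of [U], in its near-covering form,
    makes one radius serve all controls. *)
Lemma dynamics_near_uniform {R : realType} {n m : nat} (T : R)
    (U : set 'rV[R]_m) (f : R -> 'rV[R]_n -> 'rV[R]_m -> 'rV[R]_n) :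
  compact U ->
  {within [set p : R * 'rV[R]_n * 'rV[R]_m | 0 <= p.1.1 <= T /\ U p.2],
     continuous (fun p => f p.1.1 p.1.2 p.2)} ->
  forall s x, 0 <= s <= T -> forall e : R, 0 < e ->
  exists2 r : R, 0 < r & forall s' y u, 0 <= s' <= T -> `|s' - s| < r ->
    `|y - x| < r -> U u -> `|f s' y u - f s x u| < e.
Proof.
move=> cU cf s x s0T e e0.
have := (compact_near_coveringP U).1 cU (R * 'rV[R]_n)%type (nbhs (s, x))
  (fun p u => U u -> 0 <= p.1 <= T -> `|f p.1 p.2 u - f s x u| < e) _.
case.
  move=> u Uu.
  have [r r0 Hr] := within_continuous_dist cf (x := (s, x, u)) (conj s0T Uu)
    (divr_gt0 e0 (ltr0Sn R 1)).
  exists (ball u r, ball (s, x) r); first by split; exact: nbhsx_ballx.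
  move=> [u' [s' y]] /= [uu' [ss' xy]] Uu' s'0T.
  have ss'r : `|s - s'| < r by move: ss'; rewrite -ball_normE.
  have xyr : `|x - y| < r by move: xy; rewrite -ball_normE.
  have uu'r : `|u - u'| < r by move: uu'; rewrite -ball_normE.
  have H1 := Hr (s', y, u') (conj s'0T Uu').
  have H2 := Hr (s, x, u') (conj s0T Uu').
  rewrite -(subrKA (f s x u)) [e]splitr.
  apply: le_lt_trans (ler_normD _ _) _; apply: ltrD.
    by rewrite distrC H1// !prod_normE/= !gt_max ss'r xyr uu'r.
  by rewrite H2// !prod_normE/= !gt_max !subrr !normr0 r0 uu'r.
move=> /= [A B] [/nbhs_ballP[r1 /= r10 H1] /nbhs_ballP[r2 /= r20 H2]] AB.
exists (Num.min r1 r2); first by rewrite lt_min r10.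
move=> s' y u s'0T; rewrite !lt_min => /andP[ss1 ss2] /andP[xy1 xy2] Uu.
by apply: (AB (s', y)) => //=; split; [apply: H1|apply: H2]; rewrite -ball_normE/= distrC.
Qed.

(** Convexity with a bare real coefficient, free of the interval subtype and of the alias
    [convex_lmodType] used by [convex_set]. *)
Definition convex_sub {R : realType} {V : lmodType R} (D : set V) : Prop :=
  forall c1 c2 (k : R), D c1 -> D c2 -> 0 <= k <= 1 -> D (k *: c1 + (1 - k) *: c2).

Lemma convex_setP {R : realType} {V : lmodType R} (D : set V) :
  convex_set (D : set (convex_lmodType V)) -> convex_sub D.
Proof.
move=> cD c1 c2 k D1 D2 /andP[k0 k1].
by have /set_mem := cD c1 c2 (Itv01 k0 k1) (mem_set D1) (mem_set D2).
Qed.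

Lemma convex_sub_thicken {R : realType} {V : normedModType R} (D : set V) (e : R) :
  convex_sub D -> convex_sub [set d | exists2 c, D c & `|d - c| <= e].
Proof.
move=> cD d1 d2 k [c1 Dc1 dc1] [c2 Dc2 dc2] /andP[k0 k1].
exists (k *: c1 + (1 - k) *: c2); first by apply: cD => //; apply/andP.
have -> : k *: d1 + (1 - k) *: d2 - (k *: c1 + (1 - k) *: c2) =
          k *: (d1 - c1) + (1 - k) *: (d2 - c2).
  by rewrite !scalerBr opprD addrACA.
apply: le_trans (ler_normD _ _) _; rewrite !normrZ.
have k1' : 0 <= 1 - k by rewrite subr_ge0.
rewrite (ger0_norm k0) (ger0_norm k1').
have := ler_wpM2l k0 dc1; have := ler_wpM2l k1' dc2; lra.
Qed.

Section trajectories.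
Context {R : realType} {n m : nat}.
Variables (T : R) (U : set 'rV[R]_m) (f : R -> 'rV[R]_n -> 'rV[R]_m -> 'rV[R]_n).
Variables (v : R -> 'rV[R]_n -> R) (B t : R) (x : 'rV[R]_n).
Implicit Types (z : R -> 'rV[R]_n) (e : R).

(* The last clause is the differential inclusion in integrated form: the mean
   velocity of z between s and s' lies, up to e, in every convex set containing
   the velocities available near (s, z s). *)
Definition almost_solution e z : Prop :=
  [/\ forall s s', `|z s - z s'| <= B * `|s - s'| + e,
      `|z t - x| <= e,
      exists sg y, [/\ 0 <= sg <= T, `|sg - T| <= e, `|y - z T| <= e & v sg y <= 0] &
      forall s s', t + e <= s -> s <= s' -> s' <= T - e ->
        forall D : set 'rV[R]_n, convex_sub D ->
        (forall sg y u, 0 <= sg <= T -> s - e <= sg <= s' + e ->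
           `|y - z s| <= B * (s' - s) + e -> U u -> D (f sg y u)) ->
        exists2 d, D d & `|z s' - z s - (s' - s) *: d| <= e].

Hypothesis T0 : 0 < T.
Hypothesis tT : 0 <= t < T.
Hypothesis B0 : 0 <= B.
Hypothesis cU : compact U.
Hypothesis cf : {within [set p : R * 'rV[R]_n * 'rV[R]_m | 0 <= p.1.1 <= T /\ U p.2],
     continuous (fun p => f p.1.1 p.1.2 p.2)}.
Hypothesis cvx : forall s x, 0 <= s <= T ->
     convex_set ([set f s x u | u in U] : set (convex_lmodType 'rV[R]_n)).
Hypothesis cv : {within [set p : R * 'rV[R]_n | 0 <= p.1 <= T],
     continuous (fun p => v p.1 p.2)}.

(** The step [h] is fixed before the index [k] is chosen, so the errors of [z k] are small even
    compared with [h]; this is what turns the integrated inclusion into a statement on difference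
    quotients. The control obtained depends on [h]. *)
Lemma almost_solution_limit :
  (forall e, 0 < e -> exists z, almost_solution e z) ->
  exists z, [/\ forall s s', `|z s - z s'| <= B * `|s - s'|,
    z t = x, v T (z T) <= 0 &
    forall s, t < s < T -> forall e, 0 < e -> exists2 d, 0 < d &
      forall h, 0 < h < d ->
        exists2 u, U u & `|z (s + h) - z s - h *: f s (z s) u| <= e * h].
Proof.
move=> Hz.
have i0 k : 0 < k.+1%:R^-1 :> R by rewrite invr_gt0.
have /choice[z zP] : forall k, exists z, almost_solution k.+1%:R^-1 z.
  by move=> k; exact: Hz.
have [|w wP] := @pointwise_cluster R n R z.
  move=> s; exists (B * `|s - t| + 1 + (1 + `|x|)) => k.
  have [H1 H2 _ _] := zP k; have k1 : k.+1%:R^-1 <= 1 :> R.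
    by rewrite invf_le1 ?ltr0Sn// ler1n.
  have -> : z k s = (z k s - z k t) + ((z k t - x) + x) by rewrite !subrK.
  have := H1 s t; have := ler_normD (z k s - z k t) ((z k t - x) + x).
  have := ler_normD (z k t - x) x; move: H2 k1; move: (_^-1) => ek; lra.
have inv_small e : 0 < e -> exists k0, forall k, (k0 <= k)%N -> k.+1%:R^-1 < e.
  move=> /natSinv_lt[k0 k0e]; exists k0 => k k0k; apply: le_lt_trans k0e.
  by rewrite lef_pV2 ?posrE ?ltr0Sn// ler_nat.
have close s1 s2 e : 0 < e -> exists k, [/\ k.+1%:R^-1 < e,
    `|z k s1 - w s1| < e & `|z k s2 - w s2| < e].
  move=> e0; have [k0 k0P] := inv_small e e0.
  by have [k [k0k ? ?]] := wP s1 s2 e k0 e0; exists k; split=> //; exact: k0P.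
exists w; split.
- move=> s s'; apply/ler_addgt0Pr => e e0.
  have [k [ke k1 k2]] := close s s' _ (divr_gt0 e0 (ltr0Sn R 2)).
  have [H1 _ _ _] := zP k; have := H1 s s'.
  have -> : w s - w s' = - (z k s - w s) + ((z k s - z k s') + (z k s' - w s')).
    by apply/rowP => j; rewrite !mxE; ring.
  move: ke; move: (_^-1) => ek ke H; apply: le_trans (ler_normD _ _) _; rewrite normrN.
  have := ler_normD (z k s - z k s') (z k s' - w s'); lra.
- apply/eqP; rewrite -subr_eq0 -normr_le0; apply/ler_addgt0Pr => e e0; rewrite add0r.
  have [k [ke k1 _]] := close t t _ (divr_gt0 e0 (ltr0Sn R 1)).
  have [_ H2 _ _] := zP k.
  have -> : w t - x = - (z k t - w t) + (z k t - x) by apply/rowP => j; rewrite !mxE; ring.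
  apply: le_trans (ler_normD _ _) _; rewrite normrN.
  move: ke H2; move: (_^-1) => ek; lra.
- rewrite leNgt; apply/negP => vT.
  have TT : 0 <= T <= T by rewrite ltW ?lexx.
  have [d d0 Hd] := within_continuous_dist cv (x := (T, w T)) TT vT.
  have [k [ke k1 _]] := close T T _ (divr_gt0 d0 (ltr0Sn R 1)).
  have [_ _ [sg [y [sgT sge ye vle]]] _] := zP k.
  move: ke sge ye; move: (_^-1) => ek ke sge ye.
  have : `|(T, w T) - (sg, y)| < d.
    rewrite prod_normE/= gt_max distrC; apply/andP; split; first lra.
    have -> : w T - y = - (z k T - w T) - (y - z k T).
      by apply/rowP => j; rewrite !mxE; ring.
    apply: le_lt_trans (ler_normB _ _) _; rewrite normrN; lra.
  move=> /(Hd (sg, y) sgT); rewrite ltNge /= => /negP; apply.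
  by apply: le_trans (ler_norm _); lra.
- move=> s /andP[ts sT] e e0.
  have s0T : 0 <= s <= T by case/andP: tT => ? _; apply/andP; split; lra.
  have e20 : 0 < e / 2 by rewrite divr_gt0.
  have [r r0 Hr] := dynamics_near_uniform cU cf (w s) s0T e20.
  (* For [h < q] both the elapsed time [h] and the displacement [B * h] fit together in [r / 4]. *)
  pose q := r / (4 * (B + 1)).
  have B0' := B0.
  have B1 : 0 < 4 * (B + 1) by lra.
  have q0 : 0 < q by rewrite divr_gt0.
  have qr : (B + 1) * q = r / 4 by rewrite /q; field; apply: lt0r_neq0; lra.
  exists (Num.min q ((T - s) / 2)); first by rewrite lt_min q0 divr_gt0// subr_gt0.
  move=> h /andP[h0]; rewrite lt_min => /andP[hq hT].
  (* Three errors below [e * h / 8] will add to the [e / 2 * h] of the thickening; [r / 4] keeps the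
     points in the radius of uniformity, and the last two bounds place [s] and [s + h] where [z k]
     satisfies the inclusion. *)
  pose p := Num.min (Num.min (e * h / 8) (r / 4)) (Num.min ((T - s) / 2) (s - t)).
  have p0 : 0 < p by rewrite !lt_min !divr_gt0 ?mulr_gt0 ?subr_gt0 ?sT ?ts.
  have [k [kp k1 k2]] := close s (s + h) _ p0.
  have [p1 p2 p3 p4] : [/\ p <= e * h / 8, p <= r / 4, p <= (T - s) / 2 & p <= s - t].
    by rewrite /p !ge_min !lexx ?orbT.
  have [_ _ _ H] := zP k; move: (i0 k) kp H; set ek := _^-1 => ek0 kp H.
  have Bh : B * h + h <= r / 4 by rewrite -qr; nra.
  have Bh0 : 0 <= B * h by rewrite mulr_ge0// ltW.
  have ss : s <= s + h by lra.
  have sT' : s + h <= T - ek by lra.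
  have tes : t + ek <= s by lra.
  (* Velocities near [(s, w s)] lie only close to the velocity set at [(s, w s)], so the inclusion
     is tested on its thickening, which is still convex. *)
  pose D := [set d | exists2 c, [set f s (w s) u | u in U] c & `|d - c| <= e / 2].
  have [||d [_ [u Uu <-] dc] Hd] := H s (s + h) tes ss sT' D.
  + by apply: convex_sub_thicken; apply: convex_setP; exact: cvx.
  + move=> sg y u sg0T /andP[sg1 sg2] yz Uu; exists (f s (w s) u); first by exists u.
    apply: ltW; apply: Hr => //.
      by rewrite ltr_norml; apply/andP; split; lra.
    rewrite -(subrK (z k s) y) -addrA; apply: le_lt_trans (ler_normD _ _) _.
    lra.
  exists u => //; move: Hd; rewrite (_ : s + h - s = h) => [Hd|]; last by ring.
  have -> : w (s + h) - w s - h *: f s (w s) u =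
      - (z k (s + h) - w (s + h)) + (z k s - w s) +
      ((z k (s + h) - z k s - h *: d) + h *: (d - f s (w s) u)).
    by rewrite scalerBr; apply/rowP => j; rewrite !mxE; ring.
  apply: le_trans (ler_normD _ _) _.
  have := ler_normD (- (z k (s + h) - w (s + h))) (z k s - w s); rewrite normrN.
  have := ler_normD (z k (s + h) - z k s - h *: d) (h *: (d - f s (w s) u)).
  rewrite normrZ (gtr0_norm h0).
  have := ler_wpM2l (ltW h0) dc; lra.
Qed.

End trajectories.

(** * Differential inclusions and controls *)

Lemma dist_within_continuous {R : realType} {V W : normedModType R} (A : set V)
    (f : V -> W) :
  (forall x, A x -> forall e : R, 0 < e ->
    exists2 d : R, 0 < d & forall y, A y -> `|x - y| < d -> `|f x - f y| < e) ->
  {within A, continuous f}.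
Proof.
move=> H; apply/subspace_continuousP => x Ax; apply/cvgrPdist_lt => e e0.
have [d d0 Hd] := H x Ax e e0; apply/nbhs_ballP; exists d => // y /=.
by rewrite -ball_normE => xy Ay; exact: Hd.
Qed.

Lemma measurable_fun_norm_rV {R : realType} {d : measure_display}
    {T : measurableType d} {n : nat} (D : set T) (h : T -> 'rV[R]_n) :
  (forall i, measurable_fun D (fun s => h s 0 i)) ->
  measurable_fun D (fun s => `|h s|).
Proof.
move=> mh; rewrite (_ : (fun s => `|h s|) =
    (fun s => \big[Num.max/0]_ij `|h s ij.1 ij.2|)); last first.
  by apply/funext => s; rewrite [LHS]/Num.Def.normr/= mx_normrE.
elim: (index_enum _) => [|[i j] r IH].
  by under eq_fun do rewrite big_nil; exact: measurable_cst.
under eq_fun do rewrite big_cons; apply: measurable_maxr => //=.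
by rewrite (ord1 i); apply: measurableT_comp => //; exact: normr_measurable.
Qed.

Lemma measurable_leb {R : realType} (A : set R) : measurable A -> leb_measurable A.
Proof.
move=> mA; exists A, set0; split; rewrite ?measure0 ?setDv ?setUid//.
Qed.

Section contingent_to_solution.
Context {R : realType} {n m : nat}.
Variables (T : R) (U : set 'rV[R]_m) (f : R -> 'rV[R]_n -> 'rV[R]_m -> 'rV[R]_n).
Variables (B t : R) (z : R -> 'rV[R]_n).

Hypothesis tT : 0 <= t < T.
Hypothesis cU : compact U.
Hypothesis U0 : U !=set0.
Hypothesis cf : {within [set p : R * 'rV[R]_n * 'rV[R]_m | 0 <= p.1.1 <= T /\ U p.2],
     continuous (fun p => f p.1.1 p.1.2 p.2)}.
Hypothesis lipz : forall s s', `|z s - z s'| <= B * `|s - s'|.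

Lemma lipschitz_abs_cont : abs_cont_on t T z.
Proof.
move=> e e0; pose M := `|B| + 1; have M0 : 0 < M by rewrite ltr_wpDl.
have BM : B <= M by rewrite (le_trans (ler_norm _))// lerDl.
exists (e / M) => [|k al bl abT _ sumd]; first by rewrite divr_gt0.
apply: (@le_lt_trans _ _ (M * \sum_(i < k) (bl i - al i))).
  rewrite mulr_sumr; apply: ler_sum => i _; apply: le_trans (lipz _ _) _.
  have [_ [ab _]] := abT i (ltn_ord i).
  by rewrite ger0_norm ?subr_ge0// ler_wpM2r// subr_ge0.
by rewrite mulrC -ltr_pdivlMr.
Qed.

Lemma lipschitz_rV_derivable_ae : exists2 w : R -> 'rV[R]_n,
  (forall i, measurable_fun setT (fun s => w s 0 i)) &
  {ae (@lebesgue_measure R), forall s, t < s < T -> is_derive s (1 : R) z (w s)}.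
Proof.
have /choice[w wP] : forall i : 'I_n, exists w : R -> R, measurable_fun setT w /\
    {ae (@lebesgue_measure R), forall s, t < s < T ->
      is_derive s (1 : R) (fun s => z s 0 i) (w s)}.
  move=> i; have [|w mw wd] := @lipschitz_derivable_ae R (fun s => z s 0 i) B t T.
    move=> s s'; apply: le_trans (lipz s s').
    by have := norm_rV_coord (z s - z s') i; rewrite !mxE.
  by exists w.
exists (fun s => \row_i w i s).
  by move=> i; under eq_fun do rewrite mxE; exact: (wP i).1.
have aeF := ae_filter_ringOfSetsType (@lebesgue_measure R).
have := filter_forall aeF (fun i => (wP i).2).
apply: filterS => s H sT.
have dz : derivable z s 1.
  by apply/derivable_mxP => i j; rewrite (ord1 i); have [] := H j sT.
split=> //; rewrite derive_mx//; apply/matrixP => i j; rewrite !mxE (ord1 i).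
by have [_ ->] := H j sT.
Qed.

Hypothesis contz : forall s, t < s < T -> forall e, 0 < e -> exists2 d, 0 < d &
  forall h, 0 < h < d ->
    exists2 u, U u & `|z (s + h) - z s - h *: f s (z s) u| <= e * h.

Let s0T s : t < s < T -> 0 <= s <= T.
Proof. by case/andP: tT => t0 _ /andP[ts sT]; rewrite !ltW// (le_lt_trans t0). Qed.

Lemma continuous_velocity_control s : 0 <= s <= T ->
  {within U, continuous (f s (z s))}.
Proof.
move=> sT; apply: dist_within_continuous => u Uu e e0.
have [d d0 Hd] := within_continuous_dist cf (x := (s, z s, u)) (conj sT Uu) e0.
exists d => // u' Uu' uu'; apply: (Hd (s, z s, u')) => //.
by rewrite !prod_normE/= !gt_max !subrr !normr0 d0.
Qed.

(** The control in [contz] varies with [h], but no limit of controls is needed: the distance from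
    [w] to the velocity set is attained by compactness, and it is below every [e] because a
    difference quotient is within [e / 2] of both. *)
Lemma derivative_velocity s w : t < s < T -> is_derive s (1 : R) z w ->
  exists2 u, U u & `|f s (z s) u - w| = 0.
Proof.
move=> sT [dz wE].
have cF : {within U, continuous (fun u => `|f s (z s) u - w|)}.
  apply: dist_within_continuous => u Uu e e0.
  have [d d0 Hd] := within_continuous_dist (continuous_velocity_control (s0T sT)) Uu e0.
  exists d => // u' Uu' uu'; apply: le_lt_trans (Hd _ Uu' uu').
  apply: le_trans (ler_dist_dist _ _) _.
  by rewrite (_ : _ - w - _ = f s (z s) u - f s (z s) u')// opprB addrA subrK.
have [c] := compact_EVT_min U0 cU cF; rewrite inE => Uc cmin.
exists c => //; apply/eqP; rewrite eq_le normr_ge0 andbT.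
apply/ler_addgt0Pr => e e0; rewrite add0r.
have e20 : 0 < e / 2 by rewrite divr_gt0.
have [d d0 Hd] := contz sT e20.
have /cvgrPdist_le/(_ _ e20)/nbhs_ballP[r /= r0 Hr] :
    h^-1 *: (z (h *: (1 : R) + s) - z s) @[h --> 0^'] --> w.
  by rewrite -wE; exact: dz.
pose h := Num.min d r / 2.
have m0 : 0 < Num.min d r by rewrite lt_min d0.
have h0 : 0 < h by rewrite divr_gt0.
have hm : h < Num.min d r by rewrite /h ltr_pdivrMr// ltr_pMr// ltr1n.
move: hm; rewrite lt_min => /andP[hd hr].
have [|u Uu Hu] := Hd h; first by rewrite h0.
have : `|w - h^-1 *: (z (h *: (1 : R) + s) - z s)| <= e / 2.
  by apply: Hr; [rewrite -ball_normE/= sub0r normrN gtr0_norm|exact: lt0r_neq0].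
rewrite [h *: _]mulr1 [h + s]addrC => Hw.
apply: (@le_trans _ _ `|f s (z s) u - w|); first by apply: cmin; rewrite inE.
have Hu' : `|h^-1 *: (z (s + h) - z s) - f s (z s) u| <= e / 2.
  rewrite -(ler_pM2l h0) -{1}(gtr0_norm h0) -normrZ scalerBr scalerA divff ?lt0r_neq0//.
  by rewrite scale1r mulrC.
rewrite distrC (splitr e); apply: le_trans (lerD Hw Hu').
by apply: le_trans (ler_normD _ _); rewrite addrA subrK.
Qed.

Lemma contingent_is_solution : exists2 u, admissible_control U t T u &
  is_solution T f t (z t) u z.
Proof.
have [w mw wd] := lipschitz_rV_derivable_ae.
have [u0 Uu0] := U0.
pose D : set R := `]t, T[%classic.
have mD : measurable D by exact: measurable_itv.
(* The zeros of [F s] are the controls producing the derivative; using the globally measurable [w]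
   makes [F] measurable in [s]. *)
pose F s u := `|f s (z s) u - w s|.
have DP s : D s -> t < s < T by rewrite /D/= in_itv.
have [|||mE [u uP mu]] := @filippov_selection R _ R m U D F cU mD.
- by move=> s u; exact: normr_ge0.
- move=> s /DP sT; apply: dist_within_continuous => u Uu e e0.
  have [d d0 Hd] := within_continuous_dist (continuous_velocity_control (s0T sT)) Uu e0.
  exists d => // u' Uu' uu'; apply: le_lt_trans (Hd _ Uu' uu').
  apply: le_trans (ler_dist_dist _ _) _.
  by rewrite (_ : _ - w s - _ = f s (z s) u - f s (z s) u')// opprB addrA subrK.
- move=> u Uu; apply: measurable_fun_norm_rV => i.
  rewrite (_ : (fun s => _) = (fun s => f s (z s) u 0 i - w s 0 i)); last first.
    by apply/funext => s; rewrite !mxE.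
  apply: measurable_funB; last exact: measurable_funTS.
  apply: subspace_continuous_measurable_fun => //.
  apply: dist_within_continuous => s /DP sT e e0.
  have [d d0 Hd] := within_continuous_dist cf (x := (s, z s, u)) (conj (s0T sT) Uu) e0.
  pose M := `|B| + 1; have M0 : 0 < M by rewrite ltr_wpDl.
  have BM : B <= M by rewrite (le_trans (ler_norm _))// lerDl.
  have M1 : 1 <= M by rewrite lerDr.
  exists (d / M) => [|s' /DP s'T]; first by rewrite divr_gt0.
  rewrite ltr_pdivlMr// => ss'.
  have := norm_rV_coord (f s (z s) u - f s' (z s') u) i; rewrite !mxE => /le_lt_trans.
  apply; apply: (Hd (s', z s', u)) => //; first by split=> //; exact: s0T.
  rewrite !prod_normE/= !gt_max subrr normr0 d0 andbT; apply/andP; split.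
    by apply: le_lt_trans ss'; rewrite ler_peMr.
  by apply: le_lt_trans (lipz _ _) _; apply: le_lt_trans ss'; rewrite mulrC ler_wpM2l.
set E := mkset _ in mE uP mu.
(* Admissibility constrains every time in [[t, T]], so outside [E] the control takes a fixed value
   in [U]. *)
exists (fun s => if s \in E then u s else u0).
  split=> [s _|i Y mY].
    by case: ifPn => // sE; rewrite inE in sE; exact: (uP _ sE).1.
  rewrite (_ : _ `&` _ = (E `&` (fun s => u s 0 i) @^-1` Y) `|`
      ((`[t, T] `\` E) `&` [set s | Y (u0 0 i)])).
    apply: measurable_leb; apply: measurableU; first exact: mu.
    apply: measurableI; first by apply: measurableD => //; exact: measurable_itv.
    have [Yu|nYu] := pselect (Y (u0 0 i)).
      by rewrite (_ : mkset _ = setT)//; apply/seteqP; split.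
    by rewrite (_ : mkset _ = set0)//; apply/seteqP; split.
  apply/seteqP; split=> s /=; rewrite in_itv/=.
    move=> [sT]; case: ifPn => [|sE Yu0]; first by rewrite inE => Es Yu; left.
    by right; split=> //; split=> //; rewrite notin_setE in sE.
  move=> [[Es Yu]|[[sT nEs] Yu0]]; last by rewrite memNset.
  rewrite mem_set//; split=> //; have [Ds _] := Es.
  by have /andP[? ?] := DP _ Ds; rewrite !ltW.
split=> //; first exact: lipschitz_abs_cont.
move: wd; apply: filterS; first exact: (ae_filter_ringOfSetsType (@lebesgue_measure R)).
move=> s dz sT; have Es : E s.
  by split; [rewrite /D/= in_itv|exact: derivative_velocity (dz sT)].
rewrite mem_set//; have [_ /eqP] := uP _ Es; rewrite normr_eq0 subr_eq0 => /eqP ->.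
exact: dz.
Qed.

End contingent_to_solution.

(** * Inf-convolution and Euler polygons *)

Lemma quadratic_is_derive {R : realType} {V : normedModType R} (p : V -> R)
    (x w : V) (l k : R) :
  (forall h : R, p (h *: w + x) = p x + h * l + h ^+ 2 * k) -> is_derive x w p l.
Proof.
move=> pE.
have H : h^-1 *: (p (h *: w + x) - p x) @[h --> 0^'] --> l.
  apply: (@cvg_trans _ ((fun h : R => l + h * k) @ 0^')).
    apply: near_eq_cvg; near=> h; rewrite pE /GRing.scale/=; field.
    by near: h; exact: nbhs_dnbhs_neq.
  have : l + h * k @[h --> (0 : R)^'] --> l + 0 * k.
    apply: cvgD; first exact: cvg_cst.
    by apply: cvgM; [exact: nbhs_dnbhs|exact: cvg_cst].
  by rewrite mul0r addr0.
by apply: DeriveDef; [apply/cvg_ex; exists l|exact/cvg_lim].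
Unshelve. all: by end_near. Qed.

Section quadratic_penalty.
Context {R : realType} {n : nat}.
Implicit Types (p q : R * 'rV[R]_n).

(** Euclidean in space-time: the norm of [R * 'rV[R]_n] is a maximum, which is not smooth. *)
Definition sqdist p q : R := (p.1 - q.1) ^+ 2 + dotv (p.2 - q.2) (p.2 - q.2).

Lemma dotv_ge0 (x : 'rV[R]_n) : 0 <= dotv x x.
Proof. by apply: sumr_ge0 => i _; rewrite -expr2 sqr_ge0. Qed.

Lemma sqdist_ge0 p q : 0 <= sqdist p q.
Proof. by rewrite addr_ge0 ?sqr_ge0 ?dotv_ge0. Qed.

Lemma sqdistxx p : sqdist p p = 0.
Proof.
rewrite /sqdist !subrr expr0n/= add0r /dotv big1// => i _.
by rewrite mxE mul0r.
Qed.

Lemma sqdist_lt p q (d : R) : 0 < d -> sqdist p q < d ^+ 2 ->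
  `|p.1 - q.1| < d /\ `|p.2 - q.2| < d.
Proof.
move=> d0 pqd.
have sq_lt (r : R) : r ^+ 2 <= sqdist p q -> `|r| < d.
  move=> /le_lt_trans/(_ pqd); rewrite -real_normK ?num_real// ltr_pXn2r// ?nnegrE//.
  exact: ltW.
split; first by apply: sq_lt; rewrite lerDl dotv_ge0.
have co i : `|(p.2 - q.2) 0 i| < d.
  apply: sq_lt; rewrite /sqdist /dotv (bigD1 i)//= expr2 addrCA lerDl.
  by rewrite addr_ge0 ?sqr_ge0// sumr_ge0// => j _; rewrite -expr2 sqr_ge0.
rewrite [ltLHS]/Num.Def.normr/= mx_normrE; apply: bigmax_lt => // -[i j] _.
by rewrite (ord1 i) co.
Qed.

Lemma dotv_le (x : 'rV[R]_n) (e : R) : `|x| <= e -> dotv x x <= n%:R * e ^+ 2.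
Proof.
move=> xe; rewrite mulr_natl -[X in _ *+ X]card_ord -sumr_const; apply: ler_sum => i _.
rewrite -expr2 -real_normK ?num_real// lerXn2r ?nnegrE//.
  exact: le_trans (normr_ge0 _) xe.
exact: le_trans (norm_rV_coord _ _) xe.
Qed.

Lemma sqdist_shift p q h (c : 'rV[R]_n) :
  sqdist (p.1 + h, p.2 + h *: c) q =
  sqdist p q + h * (2 * ((p.1 - q.1) + dotv (p.2 - q.2) c)) + h ^+ 2 * (1 + dotv c c).
Proof.
rewrite /sqdist /dotv /=.
have -> : \sum_(i < n) (p.2 + h *: c - q.2) 0 i * (p.2 + h *: c - q.2) 0 i =
  \sum_(i < n) (p.2 - q.2) 0 i * (p.2 - q.2) 0 i +
  (2 * h * \sum_(i < n) (p.2 - q.2) 0 i * c 0 i + h ^+ 2 * \sum_(i < n) c 0 i * c 0 i).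
  by rewrite !mulr_sumr -!big_split/=; apply: eq_bigr => i _; rewrite !mxE; ring.
ring.
Qed.

Variables (lam : R) (p : R * 'rV[R]_n).
Hypothesis lam0 : 0 < lam.

(** The sign makes [v - penalty] the function minimised in the inf-convolution at [p], so an
    interior minimiser is a point where [penalty] tests [v] from below. *)
Definition penalty q : R := - (sqdist p q / (2 * lam)).

Definition dpenalty q (w : R * 'rV[R]_n) : R :=
  ((p.1 - q.1) * w.1 + dotv (p.2 - q.2) w.2) / lam.

Lemma penalty_is_derive q w : is_derive q w penalty (dpenalty q w).
Proof.
apply: (@quadratic_is_derive _ _ _ _ _ _ (- (w.1 ^+ 2 + dotv w.2 w.2) / (2 * lam))).
move=> h; rewrite /penalty /dpenalty /sqdist /dotv /=.
have -> : \sum_(i < n) (p.2 - (h *: w.2 + q.2)) 0 i * (p.2 - (h *: w.2 + q.2)) 0 i =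
  \sum_(i < n) (p.2 - q.2) 0 i * (p.2 - q.2) 0 i +
  (- (2 * h) * \sum_(i < n) (p.2 - q.2) 0 i * w.2 0 i + h ^+ 2 * \sum_(i < n) w.2 0 i * w.2 0 i).
  by rewrite !mulr_sumr -!big_split/=; apply: eq_bigr => i _; rewrite !mxE; ring.
by rewrite /GRing.scale/=; field; rewrite lt0r_neq0.
Qed.

Lemma time_deriv_penalty q : time_deriv penalty q = (p.1 - q.1) / lam.
Proof.
rewrite /time_deriv; have [_ ->] := penalty_is_derive q (1, 0).
rewrite /dpenalty/= mulr1 /dotv big1 ?addr0// => i _.
by rewrite [X in _ * X]mxE mulr0.
Qed.

Lemma grad_penalty q : grad penalty q = lam^-1 *: (p.2 - q.2).
Proof.
apply/rowP => i; rewrite !mxE.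
have [_ ->] := penalty_is_derive q (0, delta_mx 0 i).
rewrite /dpenalty/= mulr0 add0r /dotv (bigD1 i)//= big1 => [|j /negbTE ji].
  by rewrite !mxE !eqxx/= mulr1 addr0 mulrC.
by rewrite [X in _ * X]mxE eqxx ji mulr0.
Qed.

Let differentiable_fst q : differentiable (fun q : R * 'rV[R]_n => q.1) q.
Proof.
have lin_fst : linear (fst : R * 'rV[R]_n -> R) by [].
pose L : {linear (R * 'rV[R]_n)%type -> R} :=
  HB.pack (fst : R * 'rV[R]_n -> R) (GRing.isLinear.Build _ _ _ _ _ lin_fst).
by apply: (@linear_differentiable _ _ _ L) => x; exact: cvg_fst.
Qed.

Let differentiable_snd_coord i q :
  differentiable (fun q : R * 'rV[R]_n => q.2 0 i) q.
Proof.
apply: (@differentiable_comp _ _ _ _ snd (fun x : 'rV[R]_n => x 0 i)).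
  have lin_snd : linear (snd : R * 'rV[R]_n -> 'rV[R]_n) by [].
  pose L : {linear (R * 'rV[R]_n)%type -> 'rV[R]_n} :=
    HB.pack (snd : R * 'rV[R]_n -> 'rV[R]_n) (GRing.isLinear.Build _ _ _ _ _ lin_snd).
  by apply: (@linear_differentiable _ _ _ L) => x; exact: cvg_snd.
exact: differentiable_coord.
Qed.

Lemma penalty_C1 Om : C1_on Om penalty.
Proof.
have dsum (F : 'I_n -> R * 'rV[R]_n -> R) q : (forall i, differentiable (F i) q) ->
    differentiable (fun q => \sum_(i < n) F i q) q.
  by move=> dF; rewrite -fct_sumE; exact: differentiable_sum.
split=> [q _|w q _].
  apply: differentiableN; apply: differentiableM; last exact: differentiable_cst.
  apply: differentiableD.
    under eq_fun do rewrite expr2; apply: differentiableM;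
      by apply: differentiableB => //; exact: differentiable_cst.
  apply: dsum => i.
  have dE : differentiable (fun q : R * 'rV[R]_n => (p.2 - q.2) 0 i) q.
    under eq_fun do rewrite !mxE.
    by apply: differentiableB => //; exact: differentiable_cst.
  exact: differentiableM.
rewrite (_ : (fun y => _) = dpenalty^~ w); last first.
  by apply/funext => y; have [_ ->] := penalty_is_derive y w.
apply: differentiable_continuous.
apply: differentiableM; last exact: differentiable_cst.
apply: differentiableD.
  apply: differentiableM; last exact: differentiable_cst.
  by apply: differentiableB => //; exact: differentiable_cst.
apply: dsum => i; apply: differentiableM; last exact: differentiable_cst.
under eq_fun do rewrite !mxE.
by apply: differentiableB => //; exact: differentiable_cst.
Qed.

End quadratic_penalty.

(** At [y = 0] the velocities are bounded by compactness of [[0, T] * U], and the Lipschitz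
    condition extends the bound. It confines all polygons to a ball fixed before the step size. *)
Lemma dynamics_linear_growth {R : realType} {n m : nat} (T L : R)
    (U : set 'rV[R]_m) (f : R -> 'rV[R]_n -> 'rV[R]_m -> 'rV[R]_n) :
  0 <= T -> compact U -> U !=set0 ->
  {within [set p : R * 'rV[R]_n * 'rV[R]_m | 0 <= p.1.1 <= T /\ U p.2],
     continuous (fun p => f p.1.1 p.1.2 p.2)} ->
  (forall s x y u, 0 <= s <= T -> U u -> `|f s x u - f s y u| <= L * `|x - y|) ->
  exists2 C : R, 0 < C & forall s y u, 0 <= s <= T -> U u ->
    `|f s y u| <= C * (1 + `|y|).
Proof.
move=> T0 cU [u0 Uu0] cf lipf.
pose A : set (R * 'rV[R]_m) := `[0, T]%classic `*` U.
have cA : compact A by apply: compact_setX => //; exact: segment_compact.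
have A0 : A !=set0 by exists (0, u0); split; rewrite //= in_itv/= lexx.
have AP p : A p -> 0 <= p.1 <= T /\ U p.2 by move=> [/= H ?]; split=> //; rewrite in_itv in H.
have cfA : {within A, continuous (fun p : R * 'rV[R]_m => `|f p.1 0 p.2|)}.
  apply: dist_within_continuous => p Ap e e0.
  have [d d0 Hd] := within_continuous_dist cf (x := (p.1, 0, p.2)) (AP _ Ap) e0.
  exists d => // q Aq; rewrite prod_normE/= gt_max => /andP[pq1 pq2].
  apply: le_lt_trans (ler_dist_dist _ _) _; apply: (Hd (q.1, 0, q.2)); first exact: AP.
  by rewrite !prod_normE/= !gt_max subrr normr0 pq1 pq2 d0.
have [c _ cmax] := compact_EVT_max A0 cA cfA.
set M := `|f c.1 0 c.2| in cmax.
have M0 : 0 <= M by exact: normr_ge0.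
exists (M + `|L| + 1) => [|s y u sT Uu]; first by rewrite ltr_wpDl// addr_ge0.
have f0 : `|f s 0 u| <= M.
  by apply: (cmax (s, u)); rewrite inE; split=> //=; rewrite in_itv.
have := lipf s y 0 u sT Uu; rewrite subr0 => fy.
have Ly : L * `|y| <= `|L| * `|y| by rewrite ler_wpM2r// ler_norm.
rewrite -(subrK (f s 0 u) (f s y u)); apply: le_trans (ler_normD _ _) _.
have := normr_ge0 y; have := normr_ge0 L; nra.
Qed.

(** * One Euler step and the inf-convolution *)

Section euler_step.
Context {R : realType} {n m : nat}.
Variables (T : R) (U : set 'rV[R]_m) (f : R -> 'rV[R]_n -> 'rV[R]_m -> 'rV[R]_n).
Variables (v : R -> 'rV[R]_n -> R) (rho M lam : R).
Hypothesis cU : compact U.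
Hypothesis U0 : U !=set0.
Hypothesis cf : {within [set p : R * 'rV[R]_n * 'rV[R]_m | 0 <= p.1.1 <= T /\ U p.2],
     continuous (fun p => f p.1.1 p.1.2 p.2)}.
Hypothesis cv : {within [set p : R * 'rV[R]_n | 0 <= p.1 <= T],
     continuous (fun p => v p.1 p.2)}.
Implicit Types (p q : R * 'rV[R]_n).
Hypothesis supersol : viscosity_supersol f U (Omega T v) v.
Hypothesis lam0 : 0 < lam.

Definition box : set (R * 'rV[R]_n) := [set q | 0 <= q.1 <= T /\ `|q.2| <= rho].

Lemma box_compact : compact box.
Proof.
rewrite (_ : box = `[0, T]%classic `*` [set x | `|x| <= rho]).
  by apply: compact_setX; [exact: segment_compact|exact: rV_closed_ball_compact].
by apply/seteqP; split=> q /=; rewrite in_itv.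
Qed.

Lemma value_bounded_on_box : exists2 M', 0 < M' &
  forall q, box q -> `|v q.1 q.2| <= M'.
Proof.
have [[q0 Bq0]|nB] := pselect (exists q, box q); last first.
  by exists 1 => // q Bq; case: nB; exists q.
have cvB : {within box, continuous (fun q => `|v q.1 q.2|)}.
  apply: dist_within_continuous => q [qT _] e e0.
  have [d d0 Hd] := within_continuous_dist cv qT e0.
  exists d => // q' [q'T _] qq'; apply: le_lt_trans (ler_dist_dist _ _) _.
  exact: Hd.
have [c _ cmax] := compact_EVT_max (ex_intro _ _ Bq0) box_compact cvB.
exists (1 + `|v c.1 c.2|) => [|q Bq]; first by rewrite ltr_pwDl.
by rewrite (le_trans (cmax q _)) ?inE// lerDr.
Qed.

Hypothesis vM : forall q, box q -> `|v q.1 q.2| <= M.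

(* p lies in the al-sublevel set of the inf-convolution of v over the box. *)
Definition infconv_le p al : Prop :=
  exists2 q, box q & v q.1 q.2 + sqdist p q / (2 * lam) <= al.

(** As [v >= - M] on the box, a level [al <= 0] leaves at most [M] for the quadratic term, hence
    [sqdist p q <= 2 * lam * M]. *)
Lemma infconv_le_close p al d : al <= 0 -> 0 < d -> 2 * lam * M < d ^+ 2 ->
  infconv_le p al ->
  exists q, [/\ box q, v q.1 q.2 <= 0, `|p.1 - q.1| < d & `|p.2 - q.2| < d].
Proof.
move=> al0 d0 lamM [q Bq qal]; exists q.
have l20 : 0 < 2 * lam by rewrite mulr_gt0.
have q0 : 0 <= sqdist p q / (2 * lam) by rewrite divr_ge0 ?sqdist_ge0 ?ltW.
have [|? ?] := @sqdist_lt _ _ p q d d0; last by split=> //; lra.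
apply: le_lt_trans lamM; rewrite mulrC -ler_pdivrMr//.
have := vM Bq; rewrite ler_norml => /andP[? _]; lra.
Qed.

Lemma sub_box_nbhs q : 0 < q.1 < T -> `|q.2| < rho -> \forall q' \near q, box q'.
Proof.
move=> /andP[q0 qT] qrho.
have c1 : {for q, continuous (fun q : R * 'rV[R]_n => q.1)} by exact: cvg_fst.
have c2 : {for q, continuous (fun q : R * 'rV[R]_n => `|q.2|)}.
  by apply: continuous_comp; [exact: cvg_snd|exact: norm_continuous].
near=> q'; split; first (apply/andP; split; apply: ltW); last apply: ltW.
- by near: q'; apply: (c1 [set x | 0 < x]); exact: lt_nbhsr.
- by near: q'; apply: (c1 [set x | x < T]); exact: lt_nbhsl.
- by near: q'; apply: (c2 [set x | x < rho]); exact: lt_nbhsl.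
Unshelve. all: by end_near. Qed.

Lemma dotv_velocity_max (s : R) (y p : 'rV[R]_n) : 0 <= s <= T ->
  exists2 u, U u & hamiltonian f U s y p = dotv (- p) (f s y u).
Proof.
move=> sT.
have cF : {within U, continuous (fun u => dotv (- p) (f s y u))}.
  apply: dist_within_continuous => u Uu e e0.
  pose k := 1 + \sum_(i < n) `|p 0 i|.
  have k0 : 0 < k by rewrite ltr_pwDl// sumr_ge0.
  have [d d0 Hd] := within_continuous_dist cf (x := (s, y, u)) (conj sT Uu) (divr_gt0 e0 k0).
  exists d => // u' Uu' uu'.
  have fd : `|f s y u - f s y u'| < e / k.
    apply: (Hd (s, y, u')) => //.
    by rewrite !prod_normE/= !gt_max !subrr !normr0 d0.
  apply: (@le_lt_trans _ _ (k * `|f s y u - f s y u'|)); last by rewrite mulrC -ltr_pdivlMr.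
  rewrite /dotv -sumrB; apply: le_trans (ler_norm_sum _ _ _) _.
  rewrite /k mulrDl mul1r ler_wpDl// mulr_suml; apply: ler_sum => i _.
  rewrite -mulrBr normrM mxE normrN ler_wpM2l//.
  by have := norm_rV_coord (f s y u - f s y u') i; rewrite !mxE.
have [c] := compact_EVT_max U0 cU cF; rewrite inE => Uc cmax.
exists c => //; apply/eqP; rewrite eq_le; apply/andP; split.
  apply: ge_sup; first by have [u0 Uu0] := U0; exists (dotv (- p) (f s y u0)), u0.
  by move=> _ [u Uu <-]; apply: cmax; rewrite inE.
apply: ub_le_sup; last by exists c.
by exists (dotv (- p) (f s y c)) => _ [u Uu <-]; apply: cmax; rewrite inE.
Qed.

(* The quadratic penalty is a test function for v at the minimiser q of the
   inf-convolution; the supersolution inequality selects a velocity along which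
   the inf-convolution does not increase to first order. *)
Lemma infconv_le_step p al d : al < 0 -> 0 < d -> 2 * lam * M < d ^+ 2 ->
  d <= p.1 <= T - d -> `|p.2| + d <= rho -> infconv_le p al ->
  exists q u, [/\ box q, U u, `|p.1 - q.1| < d, `|p.2 - q.2| < d &
    forall h b, 0 <= h -> `|f q.1 q.2 u| <= b ->
      infconv_le (p.1 + h, p.2 + h *: f q.1 q.2 u)
        (al + h ^+ 2 * ((1 + n%:R * b ^+ 2) / (2 * lam)))].
Proof.
move=> al0 d0 lamM /andP[dp pT] prho [q0 Bq0 q0al].
have l20 : 0 < 2 * lam by rewrite mulr_gt0.
have cPhi : {within box, continuous (fun q => v q.1 q.2 + sqdist p q / (2 * lam))}.
  rewrite (_ : (fun q => _) = (fun q => v q.1 q.2) \- penalty lam p); last first.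
    by apply/funext => q; rewrite /penalty/= opprK.
  move=> q; apply: continuousB.
    by move: q; apply: continuous_subspaceW cv => q [].
  move: q; apply: continuous_subspaceT => q.
  by apply: differentiable_continuous; exact: (penalty_C1 p lam0 setT).1.
have [q] := compact_EVT_min (ex_intro _ _ Bq0) box_compact cPhi.
rewrite inE => Bq qmin.
have qal : v q.1 q.2 + sqdist p q / (2 * lam) <= al.
  by apply: le_trans q0al; apply: qmin; rewrite inE.
have qq0 : 0 <= sqdist p q / (2 * lam) by rewrite divr_ge0 ?sqdist_ge0 ?ltW.
have [|pq1 pq2] := @sqdist_lt _ _ p q d d0.
  apply: le_lt_trans lamM; rewrite mulrC -ler_pdivrMr//.
  have := vM Bq; rewrite ler_norml => /andP[? _]; lra.
(* The margins [d] assumed around [p] keep [q] interior to the box, so the minimum over the box is a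
   local one; [v q.1 q.2 <= al < 0] then puts [q] in [Omega]. *)
have qT : 0 < q.1 < T.
  by move: pq1; rewrite ltr_norml => /andP[? ?]; apply/andP; split; lra.
have qT' : 0 <= q.1 <= T by have /andP[? ?] := qT; rewrite !ltW.
have qrho : `|q.2| < rho.
  rewrite -(subrK p.2 q.2); apply: le_lt_trans (ler_normD _ _) _.
  rewrite distrC; lra.
have Oq : Omega T v q by split=> //; lra.
have := supersol (penalty_C1 p lam0 (Omega T v)) Oq.
have near_min : \forall z \near q,
    v q.1 q.2 - penalty lam p q <= v z.1 z.2 - penalty lam p z.
  have := sub_box_nbhs qT qrho; apply: filterS => z Bz.
  by rewrite /penalty !opprK; apply: qmin; rewrite inE.
move=> /(_ near_min).
have [u Uu ->] := dotv_velocity_max q.2 (grad (penalty lam p) q) qT'.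
rewrite time_deriv_penalty// grad_penalty// => ineq.
(* The supersolution inequality multiplied by [lam]; its left side is half the coefficient of [h] in
   [sqdist_shift]. *)
have vel : (p.1 - q.1) + dotv (p.2 - q.2) (f q.1 q.2 u) <= 0.
  have E : dotv (- (lam^-1 *: (p.2 - q.2))) (f q.1 q.2 u) =
      - (lam^-1 * dotv (p.2 - q.2) (f q.1 q.2 u)).
    rewrite /dotv mulr_sumr -sumrN; apply: eq_bigr => i _; rewrite !mxE; ring.
  move: ineq; rewrite E; set dv := dotv _ _ => ineq.
  have := mulr_ge0 (ltW lam0) ineq.
  rewrite (_ : lam * _ = - (p.1 - q.1 + dv)); last by field; rewrite lt0r_neq0.
  lra.
(* The same [q] is a competitor for the shifted point, so only the quadratic term changes. *)
exists q, u; split=> // h b h0 fb; exists q => //.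
rewrite sqdist_shift mulrDl mulrDl addrA; apply: lerD; last first.
  rewrite -mulrA; apply: ler_wpM2l; first exact: sqr_ge0.
  by apply: ler_wpM2r; [rewrite invr_ge0 ltW|rewrite lerD2l dotv_le].
have : h * (2 * (p.1 - q.1 + dotv (p.2 - q.2) (f q.1 q.2 u))) / (2 * lam) <= 0.
  by rewrite pmulr_lle0 ?invr_gt0// mulr_ge0_le0// mulr_ge0_le0.
lra.
Qed.

End euler_step.

Section euler_polygon.
Context {R : realType} {n m : nat}.
Variables (T : R) (U : set 'rV[R]_m) (f : R -> 'rV[R]_n -> 'rV[R]_m -> 'rV[R]_n).

(** [(s, y)] stands for the minimiser of the inf-convolution, hence a velocity taken only within [d]
    of the vertex. *)
Definition euler_polygon (B d h t : R) (N : nat) (zz : nat -> 'rV[R]_n) : Prop :=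
  forall i, (i < N)%N -> exists s y u, [/\ 0 <= s <= T, U u,
    `|t + i%:R * h - s| < d, `|zz i - y| < d &
    `|f s y u| <= B /\ zz i.+1 = zz i + h *: f s y u].

Variables (v : R -> 'rV[R]_n -> R) (C rho M lam d h t : R) (x : 'rV[R]_n) (N : nat).

Hypothesis cU : compact U.
Hypothesis U0 : U !=set0.
Hypothesis cf : {within [set p : R * 'rV[R]_n * 'rV[R]_m | 0 <= p.1.1 <= T /\ U p.2],
     continuous (fun p => f p.1.1 p.1.2 p.2)}.
Hypothesis cv : {within [set p : R * 'rV[R]_n | 0 <= p.1 <= T],
     continuous (fun p => v p.1 p.2)}.
Hypothesis supersol : viscosity_supersol f U (Omega T v) v.
Hypothesis C0 : 0 < C.
Hypothesis growth : forall s y u, 0 <= s <= T -> U u -> `|f s y u| <= C * (1 + `|y|).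
Hypothesis lam0 : 0 < lam.
Hypothesis vM : forall q, box T rho q -> `|v q.1 q.2| <= M.
Hypothesis d01 : 0 < d <= 1.
Hypothesis lamM : 2 * lam * M < d ^+ 2.
Hypothesis h0 : 0 < h.
Hypothesis dt : d <= t.
Hypothesis tNT : t + N%:R * h = T - d.
Hypothesis rhoN : (1 + h * C) ^+ N * (`|x| + 2) <= rho.

Let B := C * rho.
Let kap := h ^+ 2 * ((1 + n%:R * B ^+ 2) / (2 * lam)).

Hypothesis v0 : v t x + N%:R * kap < 0.

Lemma euler_polygon_exists : exists zz : nat -> 'rV[R]_n,
  [/\ zz 0%N = x, euler_polygon B d h t N zz,
      forall i, (i <= N)%N -> `|zz i| + 2 <= rho &
      exists s y, [/\ 0 <= s <= T, v s y <= 0, `|T - d - s| < d & `|zz N - y| < d]].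
Proof.
have [d0 d1] := andP d01; have hC0 : 0 < h * C by rewrite mulr_gt0.
have hC1 : 1 <= 1 + h * C by rewrite lerDl ltW.
have x2 : 0 < `|x| + 2 by rewrite ltr_wpDl.
have kap0 : 0 <= kap.
  apply: mulr_ge0; first exact: sqr_ge0.
  by apply: divr_ge0; [rewrite addr_ge0// mulr_ge0// sqr_ge0|rewrite mulr_ge0// ltW].
(* A discrete Gronwall bound. The shift by 2 makes it multiplicative: the velocity point satisfies
   [|y| <= |z| + 1], so the speed is at most [C * (|z| + 2)]. *)
pose good i (z : 'rV[R]_n) := `|z| + 2 <= (1 + h * C) ^+ i * (`|x| + 2) /\
  infconv_le T v rho lam (t + i%:R * h, z) (v t x + i%:R * kap).
have good_rho i z : (i <= N)%N -> good i z -> `|z| + 2 <= rho.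
  move=> iN [zi _]; apply: le_trans rhoN; apply: le_trans zi _.
  by rewrite ler_wpM2r ?(ltW x2)// ler_weXn2l.
have time_le i : (i <= N)%N -> d <= t + i%:R * h <= T - d.
  move=> iN; apply/andP; split; first by rewrite (le_trans dt)// lerDl mulr_ge0// ltW.
  by rewrite -tNT lerD2l ler_wpM2r ?(ltW h0)// ler_nat.
have val_lt0 i : (i <= N)%N -> v t x + i%:R * kap < 0.
  by move=> iN; apply: le_lt_trans v0; rewrite lerD2l ler_wpM2r// ler_nat.
have step i z : (i < N)%N -> good i z -> exists z', good i.+1 z' /\
    exists s y u, [/\ 0 <= s <= T, U u, `|t + i%:R * h - s| < d, `|z - y| < d &
      `|f s y u| <= B /\ z' = z + h *: f s y u].
  move=> iN gi; have zr := good_rho _ _ (ltnW iN) gi; have [zi infi] := gi.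
  have zd : `|z| + d <= rho by lra.
  have [[s y] [u [[/= sT yr] Uu ts zy H]]] := infconv_le_step cU U0 cf cv supersol lam0 vM
    (p := (t + i%:R * h, z)) (val_lt0 _ (ltnW iN)) d0 lamM (time_le _ (ltnW iN)) zd infi.
  have yz : `|y| <= `|z| + 1.
    rewrite -(subrK z y); apply: le_trans (ler_normD _ _) _.
    rewrite distrC; move: zy => /=; lra.
  have fz : `|f s y u| <= C * (`|z| + 2).
    apply: le_trans (growth _ sT Uu) _; rewrite ler_wpM2l ?(ltW C0)//; lra.
  have fB : `|f s y u| <= B by apply: le_trans fz _; rewrite /B ler_wpM2l// ltW.
  exists (z + h *: f s y u); split; last by exists s, y, u.
  split.
    rewrite exprS -mulrA; apply: le_trans (_ : (1 + h * C) * (`|z| + 2) <= _); last first.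
      by rewrite ler_wpM2l// (le_trans _ hC1).
    have := ler_normD z (h *: f s y u); rewrite normrZ (gtr0_norm h0).
    have := ler_wpM2l (ltW h0) fz; lra.
  have := H h B (ltW h0) fB; rewrite -/kap /=.
  rewrite (_ : t + i%:R * h + h = t + i.+1%:R * h); last by rewrite -natr1; ring.
  by rewrite (_ : v t x + i%:R * kap + kap = v t x + i.+1%:R * kap)//; rewrite -natr1; ring.
have /choice[F FP] : forall p : nat * 'rV[R]_n, exists z', (p.1 < N)%N -> good p.1 p.2 ->
    good p.1.+1 z' /\
    exists s y u, [/\ 0 <= s <= T, U u, `|t + p.1%:R * h - s| < d, `|p.2 - y| < d &
      `|f s y u| <= B /\ z' = p.2 + h *: f s y u].
  move=> [i z] /=; have [[iN gi]|nG] := pselect ((i < N)%N /\ good i z).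
    by have [z' ?] := step _ _ iN gi; exists z'.
  by exists 0 => iN gi; case: nG.
pose zz := fix zz i := if i is j.+1 then F (j, zz j) else x.
have gz i : (i <= N)%N -> good i (zz i).
  elim: i => [_|i IH iN]; last by have [] := FP (i, zz i) iN (IH (ltnW iN)).
  split; first by rewrite expr0 mul1r.
  exists (t, x); last by rewrite mul0r addr0 sqdistxx mul0r mul0r.
  split; last by have := rhoN; have := exprn_ege1 N hC1; have := normr_ge0 x => /=; nra.
  have := time_le 0%N (leq0n N); rewrite mul0r addr0 => /andP[? ?] /=.
  by apply/andP; split; lra.
exists zz; split=> //.
- by move=> i iN; have [_] := FP (i, zz i) iN (gz _ (ltnW iN)).
- by move=> i iN; exact: good_rho (gz _ iN).
- have [_ infN] := gz N (leqnn N).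
  have [[s y] [[/= sT _] vs ts zy]] :=
    infconv_le_close lam0 vM (ltW (val_lt0 _ (leqnn N))) d0 lamM infN.
  by exists s, y; split=> //; rewrite -tNT.
Qed.

End euler_polygon.

(** * Piecewise constant interpolation of a polygon *)

Section polygon_interpolation.
Context {R : realType} {n m : nat}.
Variables (T : R) (U : set 'rV[R]_m) (f : R -> 'rV[R]_n -> 'rV[R]_m -> 'rV[R]_n).
Variables (B d h t : R) (N : nat) (zz : nat -> 'rV[R]_n).
Hypothesis h0 : 0 < h.
Hypothesis B0 : 0 <= B.
Hypothesis tNT : t + N%:R * h = T - d.
Hypothesis polygon : euler_polygon T U f B d h t N zz.

(** Clipped at both ends, since [Num.truncn] vanishes on negative reals: the interpolation is then
    defined on all of [R], where [almost_solution] asks for its Lipschitz bound. *)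
Definition grid_index (s : R) : nat := minn N (Num.truncn ((s - t) / h)).

Lemma grid_index_homo s s' : s <= s' -> (grid_index s <= grid_index s')%N.
Proof.
move=> ss'; rewrite leq_min geq_minl/=; apply: leq_trans (geq_minr _ _) _.
by apply: Num.Theory.le_truncn; rewrite ler_wpM2r ?invr_ge0 ?(ltW h0)// lerD2r.
Qed.

Lemma grid_index_le s : (grid_index s <= N)%N. Proof. exact: geq_minl. Qed.

Lemma grid_index_sub s s' : s <= s' ->
  (grid_index s' - grid_index s)%:R * h <= (s' - s) + h.
Proof.
move=> ss'; pose a := Num.truncn ((s - t) / h); pose a' := Num.truncn ((s' - t) / h).
have aa' : (grid_index s' - grid_index s <= a' - a)%N.
  by rewrite /grid_index -/a -/a'; case: (leqP N a); case: (leqP N a'); lia.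
apply: (@le_trans _ _ ((a' - a)%:R * h)); first by rewrite ler_wpM2r ?(ltW h0)// ler_nat.
have [a'a|/ltnW aa] := leqP a' a.
  move: a'a; rewrite -subn_eq0 => /eqP ->; rewrite mul0r; move: h0; lra.
have := truncnS_gt ((s - t) / h); rewrite -/a -natr1 ltr_pdivrMr// => Xa.
rewrite natrB//; have [X0|X0] := leP 0 ((s' - t) / h).
  have := truncn_le ((s' - t) / h); rewrite X0 -/a' ler_pdivlMr// => Xa'; lra.
have a'0 : a' = 0%N by apply/Num.Theory.truncn0Pn; rewrite -ltNge; apply: lt_trans X0 _.
have a0 : a = 0%N by apply/eqP; rewrite -leqn0 -a'0.
by rewrite a'0 a0 subrr mul0r; move: h0; lra.
Qed.

Lemma grid_index_itv s : t <= s -> s <= T - d ->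
  t + (grid_index s)%:R * h <= s < t + (grid_index s)%:R * h + h.
Proof.
move=> ts sT; have X0 : 0 <= (s - t) / h by rewrite divr_ge0 ?subr_ge0// ltW.
have -> : grid_index s = Num.truncn ((s - t) / h).
  apply/minn_idPr; rewrite -(@ler_nat R).
  apply: (@le_trans _ _ ((s - t) / h)); first by rewrite truncn_le.
  by rewrite ler_pdivrMr//; move: tNT; lra.
have := truncn_itv X0; rewrite ler_pdivlMr// ltr_pdivrMr// -natr1 => /andP[? ?].
by apply/andP; split; lra.
Qed.

Lemma polygon_displacement i k : (i + k <= N)%N ->
  `|zz (i + k)%N - zz i| <= k%:R * h * B.
Proof.
elim: k => [|k IH]; first by rewrite addn0 subrr normr0 !mul0r.
rewrite addnS => ikN; have [s [y [u [_ _ _ _ [fB ->]]]]] := polygon ikN.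
rewrite addrAC; apply: le_trans (ler_normD _ _) _.
rewrite normrZ (gtr0_norm h0) -natr1.
have := IH (ltnW ikN); have := ler_wpM2l (ltW h0) fB; lra.
Qed.

(** The mean of [k] velocities stays in [D], by induction with weights [k / (k + 1)] and
    [1 / (k + 1)]; [d0] provides the element for [k = 0]. *)
Lemma polygon_mean_velocity (D : set 'rV[R]_n) d0 i k : convex_sub D -> D d0 ->
  (forall j, (i <= j < i + k)%N -> exists2 c, D c & zz j.+1 = zz j + h *: c) ->
  exists2 c, D c & zz (i + k)%N - zz i = (k%:R * h) *: c.
Proof.
move=> cD Dd0; elim: k => [_|k IH H].
  by exists d0 => //; rewrite addn0 subrr mul0r scale0r.
have [j /andP[ij jk]|c Dc zc] := IH; first by apply: H; rewrite ij addnS ltnS ltnW.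
have [|c' Dc' zc'] := H (i + k)%N; first by rewrite leq_addr addnS leqnn.
have k0 : k.+1%:R != 0 :> R by rewrite pnatr_eq0.
exists ((k%:R / k.+1%:R) *: c + (1 - k%:R / k.+1%:R) *: c').
  apply: cD => //; rewrite divr_ge0//= ler_pdivrMr ?ltr0Sn// mul1r ler_nat.
  exact: leqnSn.
rewrite addnS zc' addrAC zc; apply/rowP => l; rewrite !mxE.
by rewrite -natr1; field; rewrite natr1.
Qed.

Definition interpolation (s : R) : 'rV[R]_n := zz (grid_index s).

Lemma interpolation_lipschitz e : B * h <= e -> forall s s',
  `|interpolation s - interpolation s'| <= B * `|s - s'| + e.
Proof.
move=> Bh; suff H s s' : s <= s' ->
    `|interpolation s' - interpolation s| <= B * (s' - s) + e.
  move=> s s'; have [ss'|/ltW s's] := leP s s'.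
    by rewrite distrC [`|s - s'|]distrC [`|s' - s|]ger0_norm ?subr_ge0// H.
  by rewrite [`|s - s'|]ger0_norm ?subr_ge0// H.
move=> ss'; have iji := subnKC (grid_index_homo ss').
have := @polygon_displacement (grid_index s) (grid_index s' - grid_index s).
rewrite iji grid_index_le => /(_ isT) H; apply: le_trans H _.
have := ler_wpM2r B0 (grid_index_sub ss'); lra.
Qed.

Lemma interpolation_inclusion e : d + h <= e -> B * h <= e -> t + d <= T ->
  (exists2 u0, U u0 & forall s, t <= s <= T -> `|f s (interpolation s) u0| <= B) ->
  0 <= d -> 0 <= t ->
  forall s s', t <= s -> s <= s' -> s' <= T - d ->
  forall D : set 'rV[R]_n, convex_sub D ->
    (forall sg y u, 0 <= sg <= T -> s - e <= sg <= s' + e ->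
       `|y - interpolation s| <= B * (s' - s) + e -> U u -> D (f sg y u)) ->
  exists2 c, D c & `|interpolation s' - interpolation s - (s' - s) *: c| <= e.
Proof.
move=> dhe Bhe tdT [u0 Uu0 fu0] d0 t0 s s' ts ss' s'T D cD DP.
have sT : s <= T - d by lra.
have t's : t <= s' by lra.
have /andP[it1 it2] := grid_index_itv ts sT.
have /andP[jt1 jt2] := grid_index_itv t's s'T.
pose i := grid_index s; pose k := (grid_index s' - grid_index s)%N.
have ik : (i + k)%N = grid_index s' by rewrite /i /k subnKC// grid_index_homo.
have ikR : (grid_index s')%:R = i%:R + k%:R :> R by rewrite -ik natrD.
have s0T : 0 <= s <= T by apply/andP; split; lra.
have Bss : 0 <= B * (s' - s) by rewrite mulr_ge0// subr_ge0.
have e0 : 0 <= e by move: h0; lra.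
(* The mean velocity must also be bounded: replacing the grid time [k%:R * h] by [s' - s] costs up
   to [h] times its norm. The control [u0] makes [D'] nonempty when no grid step separates [s] from
   [s']. *)
pose D' := [set c | D c /\ `|c| <= B].
have cD' : convex_sub D'.
  move=> c1 c2 q [D1 c1B] [D2 c2B] q01; split; first exact: cD.
  have /andP[q0 q1] := q01; have q1' : 0 <= 1 - q by rewrite subr_ge0.
  apply: le_trans (ler_normD _ _) _; rewrite !normrZ (ger0_norm q0) (ger0_norm q1').
  have := ler_wpM2l q0 c1B; have := ler_wpM2l q1' c2B; lra.
have D'0 : D' (f s (interpolation s) u0).
  split; last by apply: fu0; rewrite ts/=; lra.
  apply: DP => //; first by apply/andP; split; lra.
  by rewrite subrr normr0 addr_ge0.
have [j /andP[ij jik]|c [Dc cB] zc] := @polygon_mean_velocity D' _ i k cD' D'0.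
  have jN : (j < N)%N by rewrite (leq_trans jik)// ik grid_index_le.
  have [sg [y [u [sgT Uu tsg zy [fB zj]]]]] := polygon jN.
  exists (f sg y u) => //; split=> //.
  have ijR : i%:R * h <= j%:R * h by rewrite ler_wpM2r ?(ltW h0)// ler_nat.
  have jkR : (j%:R + 1) * h <= (i%:R + k%:R) * h.
    by rewrite ler_wpM2r ?(ltW h0)// natr1 -natrD ler_nat.
  apply: DP => //.
    move: tsg; rewrite ltr_norml => /andP[? ?]; rewrite -/i ikR in it1 it2 jt1 jt2.
    by apply/andP; split; lra.
  have jiN : (i + (j - i) <= N)%N by rewrite subnKC// ltnW.
  have := polygon_displacement jiN; rewrite subnKC// natrB// => Hd.
  have Bd : (j%:R - i%:R) * h * B <= (s' - s) * B.
    by rewrite ler_wpM2r//; rewrite -/i ikR in it1 it2 jt1 jt2; lra.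
  rewrite (_ : y - interpolation s = - (zz j - y) + (zz j - zz i)); last first.
    by rewrite opprB addrA subrK.
  apply: le_trans (ler_normD _ _) _; rewrite normrN; move: h0; lra.
exists c => //; rewrite /interpolation -ik zc -scalerBl normrZ.
have khs : `|k%:R * h - (s' - s)| <= h.
  by rewrite -/i ikR in it1 it2 jt1 jt2; rewrite ler_norml; apply/andP; split; lra.
apply: le_trans Bhe; rewrite mulrC; apply: le_trans (ler_wpM2l _ khs) _ => //.
by rewrite ler_wpM2r// ltW.
Qed.

End polygon_interpolation.

Lemma grid_index_eq0 {R : realType} (h t s : R) N : 0 < h -> s <= t ->
  grid_index h t N s = 0%N.
Proof.
move=> h0 st; apply/eqP; rewrite -leqn0; apply: leq_trans (geq_minr _ _) _.
rewrite leqn0; apply/eqP/Num.Theory.truncn0Pn; rewrite -ltNge.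
by apply: le_lt_trans ltr01; rewrite pmulr_lle0 ?invr_gt0// subr_le0.
Qed.

Lemma grid_index_eqN {R : realType} (h t s : R) N : 0 < h -> t + N%:R * h <= s ->
  grid_index h t N s = N.
Proof.
move=> h0 ts; apply/minn_idPl; rewrite truncn_ge_nat.
  by rewrite ler_pdivlMr//; lra.
by rewrite divr_ge0 ?(ltW h0)// subr_ge0; apply: le_trans ts; rewrite lerDl mulr_ge0// ltW.
Qed.

(** * Choice of the constants, and conclusion *)

Lemma almost_solutions_exist {R : realType} {n m : nat} (T : R) (U : set 'rV[R]_m)
    (f : R -> 'rV[R]_n -> 'rV[R]_m -> 'rV[R]_n) (v : R -> 'rV[R]_n -> R) (L t : R) x :
  compact U -> U !=set0 ->
  {within [set p : R * 'rV[R]_n * 'rV[R]_m | 0 <= p.1.1 <= T /\ U p.2],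
     continuous (fun p => f p.1.1 p.1.2 p.2)} ->
  (forall s x y u, 0 <= s <= T -> U u -> `|f s x u - f s y u| <= L * `|x - y|) ->
  {within [set p : R * 'rV[R]_n | 0 <= p.1 <= T], continuous (fun p => v p.1 p.2)} ->
  viscosity_supersol f U (Omega T v) v ->
  0 <= t < T -> v t x <= 0 -> classZ (v t) ->
  exists2 B, 0 <= B & forall e, 0 < e -> exists z, almost_solution T U f v B t x e z.
Proof.
move=> cU U0 cf lipf cv sup /andP[t0 tT] vtx Zt.
have T0 : 0 < T by exact: le_lt_trans tT.
have [C C0 growth] := dynamics_linear_growth (ltW T0) cU U0 cf lipf.
(* The Gronwall factor over [[0, T]], with 3 = 2 + 1 because the start [x1] lies within 1 of [x]. *)
pose rho := expR (C * T) * (`|x| + 3).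
have rho0 : 0 <= rho by rewrite mulr_ge0 ?expR_ge0// addr_ge0.
pose B := C * rho; have B0 : 0 <= B by rewrite mulr_ge0// ltW.
have [M M0 vM] := value_bounded_on_box rho cv.
exists B => // e e0.
have [x1 x1x vx1] : exists2 x1, `|x1 - x| < Num.min e 1 & v t x1 < 0.
  have m0 : 0 < Num.min e 1 by rewrite lt_min e0 ltr01.
  move: vtx; rewrite le_eqVlt => /orP[/eqP vx0|vx0]; last by exists x; rewrite ?subrr ?normr0.
  by have [x1 [? ?]] := Zt x vx0 _ m0; exists x1.
move: x1x; rewrite lt_min => /andP[x1e x11].
have t0T : 0 <= t <= T by rewrite t0 ltW.
have vx1' : 0 < - v t x1 by rewrite oppr_gt0.
have [r r0 Hr] := within_continuous_dist cv (x := (t, x1)) t0T vx1'.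
pose q1 := Num.min (Num.min (r / 2) e) ((T - t) / 2).
have q10 : 0 < q1 by rewrite !lt_min e0 !divr_gt0 ?subr_gt0.
have [q1r q1e q1T] : [/\ q1 <= r / 2, q1 <= e & q1 <= (T - t) / 2].
  by rewrite /q1 !ge_min !lexx ?orbT.
pose t1 := t + q1.
have t10 : 0 < t1 by rewrite /t1; lra.
have t1T : t1 < T by rewrite /t1; lra.
have t10T : 0 <= t1 <= T by rewrite !ltW.
have vt1 : v t1 x1 < 0.
  have tq : `|(t, x1) - (t1, x1)| < r.
    rewrite prod_normE/= subrr normr0 gt_max r0 andbT.
    rewrite (_ : t - t1 = - q1) ?normrN ?gtr0_norm//; last by rewrite /t1; ring.
    lra.
  by have := Hr (t1, x1) t10T tq; rewrite distrC => /ltr_normlW /=; lra.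
pose d := Num.min (Num.min 1 (e / 4)) (Num.min t1 ((T - t1) / 4)).
have d0 : 0 < d by rewrite !lt_min ltr01 t10 !divr_gt0 ?subr_gt0.
have [d1 de dt1 dT] : [/\ d <= 1, d <= e / 4, d <= t1 & d <= (T - t1) / 4].
  by rewrite /d !ge_min !lexx ?orbT.
pose lam := d ^+ 2 / (4 * M).
have d20 : 0 < d ^+ 2 by rewrite exprn_gt0.
have lam0 : 0 < lam by rewrite divr_gt0// mulr_gt0.
have lamM : 2 * lam * M < d ^+ 2.
  have -> : 2 * lam * M = d ^+ 2 / 2 by rewrite /lam; field; rewrite lt0r_neq0.
  lra.
pose K := (1 + n%:R * B ^+ 2) / (2 * lam).
have K0 : 0 <= K.
  by apply: divr_ge0; [rewrite addr_ge0// mulr_ge0// sqr_ge0|rewrite mulr_ge0// ltW].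
pose S := T - d - t1; have S0 : 0 < S by rewrite /S; lra.
have ST : S <= T by rewrite /S; lra.
(* Bounds on [h]: the first two absorb the time step and the jumps [B * h] into [e], the third keeps
   the total increase [S * h * K] below [- v t1 x1]. *)
pose q := Num.min (Num.min (e / 4) (e / (B + 1))) (- v t1 x1 / (S * K + 1)).
have B1 : 0 < B + 1 by lra.
have SK1 : 0 < S * K + 1 by rewrite ltr_wpDl// mulr_ge0// ltW.
have q0 : 0 < q by rewrite !lt_min !divr_gt0 ?oppr_gt0.
have [qe qB qv] : [/\ q <= e / 4, q <= e / (B + 1) & q <= - v t1 x1 / (S * K + 1)].
  by rewrite /q !ge_min !lexx ?orbT.
have [k kq] := natSinv_lt (divr_gt0 q0 S0).
pose N := k.+1; have N0 : 0 < N%:R :> R by rewrite ltr0Sn.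
pose h := S / N%:R.
have h0 : 0 < h by rewrite divr_gt0.
have hq : h < q by move: kq; rewrite ltr_pdivlMr// mulrC.
have NhS : N%:R * h = S by rewrite /h mulrC divfK// lt0r_neq0.
have tNT : t1 + N%:R * h = T - d by rewrite NhS /S; ring.
have Bhe : B * h <= e.
  have := le_trans (ltW hq) qB; rewrite ler_pdivlMr// mulrC; lra.
have dhe : d + h <= e by lra.
have rhoN : (1 + h * C) ^+ N * (`|x1| + 2) <= rho.
  rewrite /rho; apply: ler_pM.
  - by rewrite exprn_ge0// addr_ge0// mulr_ge0// ltW.
  - by rewrite addr_ge0.
  - apply: (@le_trans _ _ (expR (h * C) ^+ N)).
      rewrite lerXn2r ?nnegrE ?expR_ge0 ?expR_ge1Dx//.
      by rewrite addr_ge0// mulr_ge0// ltW.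
    rewrite -expRM_natl ler_expR mulrA NhS mulrC.
    by rewrite ler_wpM2l// ltW.
  - have := ler_normD (x1 - x) x; rewrite subrK; lra.
have v0 : v t1 x1 + N%:R * (h ^+ 2 * ((1 + n%:R * (C * rho) ^+ 2) / (2 * lam))) < 0.
  rewrite -/B -/K (_ : _ * (h ^+ 2 * K) = (N%:R * h) * (h * K)); last by ring.
  rewrite NhS.
  have := lt_le_trans hq qv; rewrite ltr_pdivlMr// => H.
  move: H h0; lra.
have d01 : 0 < d <= 1 by rewrite d0.
have [zz [z0 zP zrho [s [y [sT vsy sd yd]]]]] := euler_polygon_exists cU U0 cf cv sup C0
  growth lam0 vM d01 lamM h0 dt1 tNT rhoN v0.
exists (interpolation h t1 N zz); split.
- exact: interpolation_lipschitz h0 B0 zP e Bhe.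
- rewrite /interpolation grid_index_eq0//; last by rewrite /t1; lra.
  by rewrite z0 ltW.
- exists s, y; split=> //.
    by move: sd; rewrite ltr_norml ler_norml => /andP[? ?]; apply/andP; split; lra.
  rewrite /interpolation grid_index_eqN//; last by rewrite tNT; lra.
  rewrite distrC; lra.
- move=> s1 s2 ts1 s12 s2T D cD DP.
  have [u0 Uu0] := U0.
  apply: (interpolation_inclusion h0 B0 tNT zP dhe Bhe _ _ (ltW d0) (ltW t10)) cD DP => //.
  + lra.
  + exists u0 => // s' /andP[t1s' s'T].
    have s'0T : 0 <= s' <= T by rewrite s'T (le_trans (ltW t10)).
    apply: le_trans (growth _ _ _ s'0T Uu0) _; rewrite /B ler_wpM2l ?(ltW C0)//.
    have := zrho _ (grid_index_le h t1 N s'); rewrite /interpolation; lra.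
  + by rewrite /t1; lra.
  + by lra.
Qed.

Unset Implicit Arguments.

Theorem theorem3 (R : realType) (n m : nat) (T : R) (U : set 'rV[R]_m)
    (f : R -> 'rV[R]_n -> 'rV[R]_m -> 'rV[R]_n) (g : 'rV[R]_n -> R)
    (vb : R -> 'rV[R]_n -> R) (gb : 'rV[R]_n -> R) :
  0 < T ->
  compact U -> U !=set0 ->
  {within [set p : R * 'rV[R]_n * 'rV[R]_m | 0 <= p.1.1 <= T /\ U p.2],
     continuous (fun p => f p.1.1 p.1.2 p.2)} ->
  (exists L : R, forall s x y u, 0 <= s <= T -> U u ->
     `|f s x u - f s y u| <= L * `|x - y|) ->
  (forall s x, 0 <= s <= T ->
     convex_set ([set f s x u | u in U] : set (convex_lmodType 'rV[R]_n))) ->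
  continuous g ->
  {within [set p : R * 'rV[R]_n | 0 <= p.1 <= T],
     continuous (fun p => vb p.1 p.2)} ->
  viscosity_supersol f U (Omega T vb) vb ->
  (forall x, vb T x = gb x) ->
  (forall t, 0 <= t <= T -> classZ (vb t)) ->
  (forall x, ~ (g x <= 0) -> 0 < gb x) ->
  forall t, 0 <= t <= T ->
    [set x | vb t x <= 0] `<=` reach_set T f U g t.
Proof.
move=> T0 cU U0 cf [L lipf] cvx cg cv sup vT Zv gpos t /andP[t0 tT] x /= vtx.
have vTg y : vb T y <= 0 -> g y <= 0.
  by move=> vy; apply: contrapT => /gpos; rewrite -vT ltNge vy.
have [tT'|Tt] := ltP t T; last first.
  have tE : t = T by apply/eqP; rewrite eq_le tT.
  rewrite tE in vtx *; have [u0 Uu0] := U0.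
  (* At the final time the trajectory is a single point, and the equation is asked on an empty
     interval. *)
  exists (fun=> u0); split.
    split=> [//|i Y mY]; apply: measurable_leb; apply: measurableI.
      by rewrite -set_itvcc; exact: measurable_itv.
    have [Yu|nYu] := pselect (Y (u0 0 i)).
      by rewrite (_ : _ @^-1` _ = setT)//; apply/seteqP; split.
    by rewrite (_ : _ @^-1` _ = set0)//; apply/seteqP; split.
  exists (fun=> x); split; last exact: vTg.
  split=> //.
    by apply: (@lipschitz_abs_cont _ _ _ 0) => s s'; rewrite subrr normr0 mul0r.
  by apply: aeW => s /andP[Ts sT]; have := lt_trans Ts sT; rewrite ltxx.
have tT2 : 0 <= t < T by rewrite t0.
have [|B B0 almost] := almost_solutions_exist cU U0 cf lipf cv sup tT2 vtx.
  by apply: Zv; rewrite t0 ltW.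
have [z [lipz zt vz contz]] := almost_solution_limit T0 tT2 B0 cU cf cvx cv almost.
have [u adm sol] := contingent_is_solution tT2 cU U0 cf lipz contz.
exists u; split=> //; exists z; split; last exact: vTg.
by rewrite zt in sol.
Qed.
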